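(* Let $\mathcal{P}_{\mathrm{SMU}}([0,M]^d,b,B)$ be the class of scale mixtures of uniform densities that are supported on $[0,M]^d$ and that are bounded above by $B$ and bounded below by $b$. There exists a positive constant $c_d$ (depending only on $d$) such that $$\inf_{\tilde p_n}\ \sup_{p_0\in\mathcal{P}_{\mathrm{SMU}}([0,M]^d,b,B)}\mathbb{E}h^2(p_0,\tilde p_n)\ge c_d\,n^{-2/3}(\log n)^{(d-1)/3}$$ whenever $B$, $1/b$, $M$ are all larger than $c_d$.
   Context: A scale mixture of uniform densities on $(0,\infty)^d$ is a density $p$ of the form $$p(u_1,\dots,u_d)=\int_{(0,\infty)^d}\prod_{j=1}^d\frac{\mathbf 1\{u_j\le\theta_j\}}{\theta_j}\,dG(\theta_1,\dots,\theta_d)\quad(u_1,\dots,u_d>0)$$ for some probability measure $G$ on $(0,\infty)^d$. The bounds by $B$ and $b$ are understood on $[0,M]^d$. The infimum is over all estimators $\tilde p_n$, i.e. measurable functions of $n$ observations $X_1,\dots,X_n$, where $X_1,\dots,X_n$ are i.i.d. with density $p_0$, $n\ge2$; the expectation is under $p_0$. $h^2(p,q):=\int(\sqrt p-\sqrt q)^2$.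
   Formalization: Two constants depending only on d replace c_d: one in the lower bound, one as threshold for B, 1/b, M. The condition b M^d ≤ 1/2 is added, since for b M^d > 1 the class is empty, for b M^d = 1 it is at most the uniform density, and the stated bound fails. *)

(* Defs.v *)
From HB Require Import structures.
From mathcomp Require Import all_boot all_order all_algebra.
From mathcomp Require Import all_classical all_reals all_analysis.
From mathcomp Require Import measurable_realfun.

Set Implicit Arguments.
Unset Strict Implicit.
Unset Printing Implicit Defensive.

Import Order.TTheory GRing.Theory Num.Theory.
Import numFieldNormedType.Exports.

Local Open Scope classical_set_scope.
Local Open Scope ring_scope.
Local Open Scope ereal_scope.

(* [n.-tuple T] carries the product sigma-algebra; the library has binary
   product measures only, so the n-fold product is obtained by transporting
   [mu \x mu^n] along [T * n.-tuple T -> n.+1.-tuple T]. *)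

Section tuple_cons_measure.
Context d (T : measurableType d) (R : realType) (n : nat).

Definition tuple_cons (z : T * n.-tuple T) : n.+1.-tuple T :=
  [the n.+1.-tuple T of z.1 :: z.2].

Lemma measurable_tuple_cons : measurable_fun setT tuple_cons.
Proof. exact: measurable_cons. Qed.

Variables (mu : {sigma_finite_measure set T -> \bar R})
          (nu : {sigma_finite_measure set (n.-tuple T) -> \bar R}).

Definition tuple_cons_measure : set (n.+1.-tuple T) -> \bar R :=
  pushforward (mu \x nu) tuple_cons.

Let measurable_preimage_tuple_cons A :
  measurable A -> measurable (tuple_cons @^-1` A).
Proof.
by move=> mA; rewrite -[X in measurable X]setTI; exact: measurable_tuple_cons.
Qed.

Let tuple_cons_measure0 : tuple_cons_measure set0 = 0.
Proof. by rewrite /tuple_cons_measure /pushforward preimage_set0 measure0. Qed.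

Let tuple_cons_measure_ge0 A : 0 <= tuple_cons_measure A.
Proof. exact: (measure_ge0 (mu \x nu)). Qed.

Let tuple_cons_measure_sigma_additive : semi_sigma_additive tuple_cons_measure.
Proof.
move=> F mF tF mUF; rewrite /tuple_cons_measure /pushforward preimage_bigcup.
apply: (measure_semi_sigma_additive (s := mu \x nu)).
- by move=> i; exact: measurable_preimage_tuple_cons.
- apply/trivIsetP => /= i j _ _ ij; rewrite -preimage_setI.
  by move/trivIsetP : tF => /(_ _ _ _ _ ij) ->//; rewrite preimage_set0.
- by rewrite -preimage_bigcup; exact: measurable_preimage_tuple_cons.
Qed.

HB.instance Definition _ := isMeasure.Build _ _ _ tuple_cons_measure
  tuple_cons_measure0 tuple_cons_measure_ge0 tuple_cons_measure_sigma_additive.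

Let tuple_cons_measure_sigma_finite : sigma_finite setT tuple_cons_measure.
Proof.
have /sigma_finiteP[F [FT ndF Foo]] := sigma_finiteT mu.
have /sigma_finiteP[G [GT ndG Goo]] := sigma_finiteT nu.
pose g (t : n.+1.-tuple T) : T * n.-tuple T := (thead t, [tuple of behead t]).
have mg : measurable_fun setT g.
  by apply/measurable_fun_pair; [exact: measurable_tnth|exact: measurable_behead].
exists (fun i => g @^-1` (F i `*` G i)).
  rewrite -preimage_bigcup (_ : \bigcup_i _ = setT) ?preimage_setT//.
  rewrite -subTset => -[x y] _.
  have [i _ Fx] : (\bigcup_i F i) x by rewrite -FT.
  have [k _ Gy] : (\bigcup_i G i) y by rewrite -GT.
  exists (maxn i k) => //; split => /=.
  - by move: x Fx; exact/subsetPset/ndF/leq_maxl.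
  - by move: y Gy; exact/subsetPset/ndG/leq_maxr.
move=> i; have [mF Fi] := Foo i; have [mG Gi] := Goo i; split.
  by rewrite -[X in measurable X]setTI; apply: mg => //; exact: measurableX.
rewrite /tuple_cons_measure /pushforward -comp_preimage.
rewrite (_ : g \o tuple_cons = id); last first.
  by apply/funext => -[x t] /=; rewrite /g theadE; congr pair; exact: val_inj.
by rewrite preimage_id product_measure1E// lte_mul_pinfty// ge0_fin_numE.
Qed.

HB.instance Definition _ := @Measure_isSigmaFinite.Build _ _ _
  tuple_cons_measure tuple_cons_measure_sigma_finite.

End tuple_cons_measure.

Fixpoint tuple_measure d (T : measurableType d) (R : realType)
    (mu : {sigma_finite_measure set T -> \bar R}) (n : nat) :
    {sigma_finite_measure set (n.-tuple T) -> \bar R} :=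
  match n with
  | 0%N => \d_([tuple] : 0.-tuple T)
  | m.+1 => tuple_cons_measure mu (tuple_measure mu m)
  end.

Notation euclidean R d := (d.-tuple (measurableTypeR R)).

Definition lebesgue (R : realType) (d : nat) :
    {sigma_finite_measure set (euclidean R d) -> \bar R} :=
  tuple_measure (@lebesgue_measure R) d.

Definition orthant (R : realType) (d : nat) : set (euclidean R d) :=
  [set u | forall j, (0 < tnth u j)%R].

Record density (R : realType) (d : nat) := Density {
  pdf :> euclidean R d -> R ;
  measurable_pdf : measurable_fun setT pdf ;
  pdf_ge0 : forall u, (0 <= pdf u)%R ;
  pdf_out : forall u, ~ orthant u -> pdf u = 0%R ;
  integral_pdf : \int[@lebesgue R d]_u (pdf u)%:E = 1 }.

Section law.
Context (R : realType) (d : nat) (p : density R d).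

Definition law : set (euclidean R d) -> \bar R :=
  fun A => \int[@lebesgue R d]_(u in A) (p u)%:E.

Let law0 : law set0 = 0.
Proof. exact: integral_set0. Qed.

Let law_ge0 A : 0 <= law A.
Proof. by apply: integral_ge0 => u _; rewrite lee_fin pdf_ge0. Qed.

Let law_sigma_additive : semi_sigma_additive law.
Proof.
move=> F mF tF mUF; rewrite /law ge0_integral_bigcup//.
- by apply: is_cvg_ereal_nneg_natsum => k _; exact: law_ge0.
- by apply/measurable_EFinP; apply: measurable_funTS; exact: measurable_pdf.
- by move=> u _; rewrite lee_fin pdf_ge0.
Qed.

HB.instance Definition _ :=
  isMeasure.Build _ _ _ law law0 law_ge0 law_sigma_additive.

Let lawT : law setT = 1.
Proof. exact: integral_pdf. Qed.

HB.instance Definition _ := @Measure_isProbability.Build _ _ _ law lawT.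

End law.

(* mixing measures on (0,oo)^d are Borel probabilities on R^d giving it mass 1 *)
Definition uniform_scale_mixture (R : realType) (d : nat)
    (G : probability (euclidean R d) R) (u : euclidean R d) : \bar R :=
  \int[G]_(theta in @orthant R d)
    (\prod_(j < d) ((tnth u j <= tnth theta j)%R%:R / tnth theta j))%:E.

Definition is_SMU (R : realType) (d : nat) (p : density R d) : Prop :=
  exists2 G : probability (euclidean R d) R, G (@orthant R d) = 1 &
    forall u, orthant u -> (p u)%:E = uniform_scale_mixture G u.

(* Densities live on (0,oo)^d, so [0,M]^d enters through its part (0,M]^d.
   The class is empty when b * M ^+ d > 1 or B * M ^+ d < 1, and it contains
   at most the uniform density when b * M ^+ d = 1. *)
Definition SMU_class (R : realType) (d : nat) (M b B : R) : set (density R d) :=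
  [set p | [/\ is_SMU p,
     forall u, orthant u -> (exists j, (M < tnth u j)%R) -> p u = 0%R &
     forall u, orthant u -> (forall j, (tnth u j <= M)%R) ->
       (b <= p u <= B)%R ]].

Definition hellinger2 (R : realType) (d : nat) (p q : euclidean R d -> R) :
    \bar R :=
  \int[@lebesgue R d]_(u in @orthant R d)
    ((Num.sqrt (p u) - Num.sqrt (q u)) ^+ 2)%R%:E.

(* Joint measurability in the sample and the argument makes the loss
   a measurable function of the sample. Estimates need not integrate to 1. *)
Definition estimator (R : realType) (d n : nat)
    (q : n.-tuple (euclidean R d) -> euclidean R d -> R) : Prop :=
  measurable_fun setT
    (fun z : n.-tuple (euclidean R d) * euclidean R d => q z.1 z.2) /\
  (forall x u, (0 <= q x u)%R).

Definition risk (R : realType) (d n : nat) (p : density R d)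
    (q : n.-tuple (euclidean R d) -> euclidean R d -> R) : \bar R :=
  \int[tuple_measure (law p) n]_x hellinger2 p (q x).

Definition minimax_risk (R : realType) (d n : nat) (P : set (density R d)) :
    \bar R :=
  ereal_inf [set ereal_sup [set risk p q | p in P] | q in @estimator R d n].

(* Main.v *)
Require Import Defs.
From HB Require Import structures.
From mathcomp Require Import all_boot all_order all_algebra.
From mathcomp Require Import all_classical all_reals all_analysis.
From mathcomp Require Import measurable_realfun ring lra zify.

(** Every positive combination of indicators of boxes [(0, tau_1] x ... x (0, tau_d]]
    that integrates to one is a scale mixture of uniforms: the mixing measure is a
    finite sum of atoms at the upper corners [tau] ([box_mixture_SMU]). The lower
    bound is Assouad's argument over a hypercube of such densities.

    Divide the cube [(0, M]^d] into dyadic boxes of relative volume [2^-k], in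
    shapes given by level vectors [(m_1, ..., m_d)] of sum [k]. There are [2^k]
    boxes of each shape, and a number of shapes of the order of [k^(d-1)]; let [N]
    be the number of pairs of a shape and a box. To each of them belongs a tensor
    product [H] of Haar functions, supported in the box, with values [1] and [-1].
    These functions are exactly orthogonal in [L2], across shapes as well
    ([haar_gram]), because two different dyadic boxes differ in some direction, where
    the two one-dimensional Haar functions are orthogonal ([node_gram_neq]). On the other
    hand [H] is a signed combination of [3^d] corner boxes with total absolute mass
    [4^d]; adding the same combination with absolute values makes the weights
    nonnegative for both signs of [H]. So every choice of signs gives a density
    in the class if the amplitude of the perturbations is a small multiple of
    [1 / (N M^d)], the remaining mass being put on the whole cube, which keeps the
    density between [1 / (2 M^d)] and [2 / M^d] ([haar_density_in_class]).

    On these densities the Hellinger distance is comparable to the [L2] distance.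
    Clipping an arbitrary estimator and using the Bessel inequality ([bessel],
    [hellinger2_bessel]) bounds its loss below by a sum over the [N] functions [H] of
    squared errors in estimating one sign. Two densities that differ by one sign
    have affinity at least [1 - 1 / (F^2 N^2 2^k)] for a constant [F], so that with
    [n] of the order of [N^2 2^k] observations the sign cannot be estimated
    ([two_point]). Averaging over the hypercube ([assouad]) gives a minimax risk of
    at least a constant times [1 / (N 2^k)] ([haar_minimax]).

    With [k = d r] and [L = (r + 1)^(d-1)] shapes one has [N = L 2^k]
    ([card_dyadic_box]); taking [n] of the order of [N^2 2^k = L^2 2^(3k)], the bound
    [1 / (L 2^(2k))] is of the order of [n^(-2/3) L^(1/3)], and [r] is of the order of
    [log n] ([rate_le]). *)

Import Order.TTheory GRing.Theory Num.Theory.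
Local Open Scope ring_scope.

Set Implicit Arguments.
Unset Strict Implicit.
Unset Printing Implicit Defensive.
Local Open Scope classical_set_scope.

(** * Integration against product measures on tuples *)

Section tuple_measure_theory.
Context d (T : measurableType d) (R : realType).
Implicit Types mu : {sigma_finite_measure set T -> \bar R}.
Local Open Scope ereal_scope.

Lemma integral_tuple_measureS mu n (F : n.+1.-tuple T -> \bar R) :
  measurable_fun setT F -> (forall t, 0 <= F t) ->
  \int[tuple_measure mu n.+1]_t F t =
  \int[mu]_x \int[tuple_measure mu n]_t F (tuple_cons (x, t)).
Proof.
move=> mF F0; rewrite /= ge0_integral_pushforward//; last first.
  exact: measurable_tuple_cons.
rewrite preimage_setT fubini_tonelli1//.
- by apply: measurableT_comp => //; exact: measurable_tuple_cons.
- by move=> z /=; exact: F0.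
Qed.

Lemma measurable_tuple_prod n (f : 'I_n -> T -> R) :
  (forall i, measurable_fun setT (f i)) ->
  measurable_fun setT (fun t : n.-tuple T => \prod_i f i (tnth t i))%R.
Proof.
move=> mf; apply: measurable_prod => i _.
by apply: measurableT_comp => //; exact: measurable_tnth.
Qed.

Lemma integral_tuple_prod mu n (f : 'I_n -> T -> R) :
  (forall i, measurable_fun setT (f i)) -> (forall i x, 0 <= f i x)%R ->
  \int[tuple_measure mu n]_t (\prod_i f i (tnth t i))%:E =
  \prod_i \int[mu]_x (f i x)%:E.
Proof.
elim: n f => [|n IH] f mf f0.
  under eq_integral do rewrite big_ord0.
  by rewrite /= integral_dirac// diracT mul1e big_ord0.
rewrite integral_tuple_measureS; last 2 first.
- by apply/measurable_EFinP; exact: measurable_tuple_prod.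
- by move=> t; rewrite lee_fin; apply: prodr_ge0 => i _.
have inner x : \int[tuple_measure mu n]_t
    (\prod_(i < n.+1) f i (tnth (tuple_cons (x, t)) i))%:E =
    (f ord0 x)%:E * \prod_(i < n) \int[mu]_x (f (lift ord0 i) x)%:E.
  rewrite -(IH (fun i => f (lift ord0 i)))// -ge0_integralZl//; last 3 first.
  - apply/measurable_EFinP.
    by apply: (@measurable_tuple_prod n (fun i => f (lift ord0 i))).
  - by move=> t _; rewrite lee_fin; apply: prodr_ge0 => i _.
  - by rewrite lee_fin.
  apply: eq_integral => t _; rewrite -EFinM big_ord_recl/= tnth0.
  by under eq_bigr => i _ do rewrite tnthS.
under eq_integral do rewrite inner.
rewrite ge0_integralZr//.
- by rewrite big_ord_recl.
- by apply/measurable_EFinP.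
- by move=> x _; rewrite lee_fin.
- by apply: prode_ge0 => i _; apply: integral_ge0 => x _; rewrite lee_fin.
Qed.

End tuple_measure_theory.

Section change_of_measure.
Context (R : realType) (d : nat).
Local Open Scope ereal_scope.
Import HBNNSimple.

(** Linearity reduces the claim to indicators, for which it is the definition of
    [law]; monotone convergence along simple functions does the rest. *)
Lemma integral_law (p : density R d) (f : euclidean R d -> \bar R) :
  measurable_fun setT f -> (forall x, 0 <= f x) ->
  \int[law p]_x f x = \int[lebesgue R d]_x (f x * (p x)%:E).
Proof.
move=> mf f0; pose h := nnsfun_approx measurableT mf.
have fE x : f x = limn (EFin \o h ^~ x).
  by apply/esym/cvg_lim => //; apply: cvg_nnsfun_approx.
have hnd x : {homo (fun n => (h n x)%:E) : a b / (a <= b)%N >-> a <= b}.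
  by move=> a b ab; rewrite lee_fin; exact/lefP/nd_nnsfun_approx.
have mp : measurable_fun setT (EFin \o p).
  by apply/measurable_EFinP; exact: measurable_pdf.
transitivity (limn (fun n => \int[law p]_x (h n x)%:E)).
  under eq_integral do rewrite fE.
  apply: monotone_convergence => [|n|n x _|x _ a b]; last exact: hnd.
  - exact: measurableT.
  - by apply/measurable_EFinP.
  - by rewrite lee_fin.
transitivity (limn (fun n => \int[lebesgue R d]_x ((h n x)%:E * (p x)%:E)));
    last first.
  rewrite -monotone_convergence//.
  - apply: eq_integral => x _; apply/cvg_lim => //.
    by apply: cvgeZr => //; apply: cvg_nnsfun_approx.
  - by move=> n; apply: emeasurable_funM => //; apply/measurable_EFinP.
  - by move=> n x _; rewrite mule_ge0 ?lee_fin ?pdf_ge0.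
  - by move=> x _ a b ab; rewrite lee_wpmul2r ?lee_fin ?pdf_ge0// -lee_fin hnd.
congr (limn _); apply/funext => n.
rewrite integralT_nnsfun sintegralE.
transitivity (\int[lebesgue R d]_x (\sum_(r \in range (h n))
    (r * \1_(h n @^-1` [set r]) x)%:E * (p x)%:E)); last first.
  apply: eq_integral => x _; rewrite -ge0_mule_fsuml.
    by rewrite fsumEFin// -fimfunE.
  by move=> r; exact: nnfun_muleindic_ge0.
rewrite ge0_integral_fsum//; last 2 first.
- move=> r; apply: emeasurable_funM => //; apply/measurable_EFinP.
  by apply: measurable_funM => //; exact: measurable_indic.
- by move=> r x _; rewrite mule_ge0 ?nnfun_muleindic_ge0 ?lee_fin ?pdf_ge0.
apply: eq_fsbigr => r /[!inE] -[x _ <-].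
under eq_integral do rewrite EFinM -muleA.
rewrite ge0_integralZl//; last 3 first.
- by apply: emeasurable_funM => //; apply/measurable_EFinP; exact: measurable_indic.
- by move=> y _; rewrite mule_ge0 ?lee_fin ?pdf_ge0.
- by rewrite lee_fin.
congr (_ * _); rewrite /= /law integral_mkcond; apply: eq_integral => y _.
by rewrite patchE indicE; case: ifP => _; rewrite ?mul1e ?mul0e.
Qed.

(** The joint law of the sample has a density, so that expectations under two
    different parameters become integrals against one common measure. *)
Lemma integral_tuple_law (p : density R d) n
    (F : n.-tuple (euclidean R d) -> \bar R) :
  measurable_fun setT F -> (forall t, 0 <= F t) ->
  \int[tuple_measure (law p) n]_t F t =
  \int[tuple_measure (lebesgue R d) n]_t (F t * (\prod_i p (tnth t i))%:E).
Proof.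
have mprod m : measurable_fun setT
    (fun t : m.-tuple (euclidean R d) => (\prod_i p (tnth t i))%:E).
  apply/measurable_EFinP; apply: (@measurable_tuple_prod _ _ _ _ (fun=> p)) => i.
  exact: measurable_pdf.
have prod0 m (t : m.-tuple (euclidean R d)) : 0 <= (\prod_i p (tnth t i))%:E.
  by rewrite lee_fin; apply: prodr_ge0 => i _; exact: pdf_ge0.
elim: n F => [|n IH] F mF F0.
  apply: eq_integral => t _.
  by rewrite big_ord0 mule1.
rewrite integral_tuple_measureS// [RHS]integral_tuple_measureS//; last 2 first.
- exact: (emeasurable_funM mF (mprod _)).
- by move=> t; rewrite mule_ge0.
have mFc : measurable_fun setT (fun z => F (tuple_cons z)).
  by apply: measurableT_comp => //; exact: measurable_tuple_cons.
under eq_integral => x _.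
  rewrite IH//; last exact: measurableT_comp mFc (measurable_pair1 x).
  over.
rewrite integral_law//; last 2 first.
- apply: (@measurable_fun_fubini_tonelli_F _ _ _ _ _ _
    (fun z => F (tuple_cons z) * (\prod_i p (tnth z.2 i))%:E)).
    apply: emeasurable_funM => //.
    exact: (measurableT_comp (mprod n) measurable_snd).
  by move=> z; rewrite mule_ge0.
- by move=> x; apply: integral_ge0 => t _; rewrite mule_ge0.
apply: eq_integral => x _.
rewrite -ge0_integralZr//; last 3 first.
- exact: emeasurable_funM (measurableT_comp mFc (measurable_pair1 x)) (mprod _).
- by move=> t _; rewrite mule_ge0.
- by rewrite lee_fin pdf_ge0.
apply: eq_integral => t _.
rewrite -muleA -EFinM mulrC big_ord_recl/= tnth0.
by under [in RHS]eq_bigr => i _ do rewrite tnthS.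
Qed.

End change_of_measure.

(** * Bounded functions on a set of finite measure, and the Bessel inequality *)

Section ge0_integral_real.
Context d (T : measurableType d) (R : realType).
Variable mu : {measure set T -> \bar R}.
Implicit Types f g : T -> R.

Lemma ge0_integralMl_real (k : R) f :
  measurable_fun setT f -> (forall x, 0 <= f x) -> 0 <= k ->
  (\int[mu]_x (k * f x)%:E = k%:E * \int[mu]_x (f x)%:E)%E.
Proof.
move=> mf f0 k0; under eq_integral do rewrite EFinM.
rewrite ge0_integralZl_EFin//; last exact/measurable_EFinP.
by move=> x _; rewrite lee_fin.
Qed.

Lemma ge0_integralD_real f g :
  measurable_fun setT f -> (forall x, 0 <= f x) ->
  measurable_fun setT g -> (forall x, 0 <= g x) ->
  (\int[mu]_x (f x + g x)%:E =
   \int[mu]_x (f x)%:E + \int[mu]_x (g x)%:E)%E.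
Proof.
move=> mf f0 mg g0; under eq_integral do rewrite EFinD.
by rewrite ge0_integralD//; try (by move=> x _; rewrite lee_fin);
  exact/measurable_EFinP.
Qed.

Lemma ge0_le_integral_real f g :
  measurable_fun setT f -> (forall x, 0 <= f x) -> measurable_fun setT g ->
  (forall x, f x <= g x) -> (\int[mu]_x (f x)%:E <= \int[mu]_x (g x)%:E)%E.
Proof.
move=> mf f0 mg fg; apply: ge0_le_integral => //.
- by move=> x _; rewrite lee_fin.
- exact/measurable_EFinP.
- exact/measurable_EFinP.
- by move=> x _; rewrite lee_fin.
Qed.

End ge0_integral_real.

Section bounded_measurable.
Context d (T : measurableType d) (R : realType).
Variables (mu : {measure set T -> \bar R}) (K : set T).
Hypotheses (mK : measurable K) (muK : (mu K < +oo)%E).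

(** An algebra of integrable functions: on a set of finite measure no further
    integrability condition has to be carried through products and sums. *)
Definition bounded_measurable (f : T -> R) :=
  measurable_fun K f /\ exists c : R, forall u, K u -> `|f u| <= c.

Lemma bounded_measurable_integrable f :
  bounded_measurable f -> mu.-integrable K (EFin \o f).
Proof.
case=> mf [c fc]; apply: measurable_bounded_integrable => //.
exists c; split; first exact: num_real.
by move=> x cx u Ku; exact: le_trans (fc u Ku) (ltW cx).
Qed.

Lemma bounded_measurable_cst r : bounded_measurable (fun=> r).
Proof. by split=> //; exists `|r|. Qed.

Lemma bounded_measurableD f g : bounded_measurable f -> bounded_measurable g ->
  bounded_measurable (fun u => f u + g u).
Proof.
move=> [mf [c fc]] [mg [c' gc]]; split; first exact: measurable_funD.
by exists (c + c') => u Ku; rewrite (le_trans (ler_normD _ _))// lerD ?fc ?gc.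
Qed.

Lemma bounded_measurableM f g : bounded_measurable f -> bounded_measurable g ->
  bounded_measurable (fun u => f u * g u).
Proof.
move=> [mf [c fc]] [mg [c' gc]]; split; first exact: measurable_funM.
by exists (c * c') => u Ku; rewrite normrM ler_pM ?fc ?gc.
Qed.

Lemma bounded_measurable_sum (I : Type) (s : seq I) (f : I -> T -> R) :
  (forall i, bounded_measurable (f i)) ->
  bounded_measurable (fun u => \sum_(i <- s) f i u).
Proof.
move=> bf; elim: s => [|i s IH].
  by under eq_fun do rewrite big_nil; exact: bounded_measurable_cst.
by under eq_fun do rewrite big_cons; exact: bounded_measurableD.
Qed.

Local Notation "\int f" := (Rintegral mu K f) (at level 10, f at level 8).

Lemma Rintegral_bmD f g : bounded_measurable f -> bounded_measurable g ->
  \int (fun u => f u + g u) = \int f + \int g.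
Proof. by move=> bf bg; rewrite RintegralD//; exact: bounded_measurable_integrable. Qed.

Lemma Rintegral_bmZ r f : bounded_measurable f ->
  \int (fun u => r * f u) = r * \int f.
Proof. by move=> bf; rewrite RintegralZl//; exact: bounded_measurable_integrable. Qed.

Lemma Rintegral_bm_sum (I : Type) (s : seq I) (f : I -> T -> R) :
  (forall i, bounded_measurable (f i)) ->
  \int (fun u => \sum_(i <- s) f i u) = \sum_(i <- s) \int (f i).
Proof.
move=> bf; elim: s => [|i s IH].
  under eq_Rintegral do rewrite big_nil.
  by rewrite Rintegral_cst// mul0r big_nil.
under eq_Rintegral do rewrite big_cons.
by rewrite Rintegral_bmD ?IH ?big_cons//; exact: bounded_measurable_sum.
Qed.

(** With [S] the orthogonal projection of [f] on the span of the [H a], expand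
    the nonnegative number that is the integral of [(f - S) ^+ 2]. *)
Lemma bessel (A : finType) (H : A -> T -> R) (v : R) (f : T -> R) :
  0 < v -> bounded_measurable f -> (forall a, bounded_measurable (H a)) ->
  (forall a b, \int (fun u => H a u * H b u) = v *+ (a == b)) ->
  v^-1 * \sum_a (\int (fun u => f u * H a u)) ^+ 2 <= \int (fun u => f u ^+ 2).
Proof.
move=> v0 bf bH orth.
pose c a := v^-1 * \int (fun u => f u * H a u).
pose S u := \sum_a c a * H a u.
have bcH a : bounded_measurable (fun u => c a * H a u).
  by apply: bounded_measurableM => //; exact: bounded_measurable_cst.
have bS : bounded_measurable S by exact: bounded_measurable_sum.
have intg g : bounded_measurable g ->
    \int (fun u => g u * S u) = \sum_a c a * \int (fun u => g u * H a u).
  move=> bg; rewrite (_ : (fun u => g u * S u) =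
    (fun u => \sum_a c a * (g u * H a u))); last first.
    by apply/funext => u; rewrite mulr_sumr; apply: eq_bigr => a _; rewrite mulrCA.
  have bgH a : bounded_measurable (fun u => g u * H a u).
    exact: bounded_measurableM.
  rewrite Rintegral_bm_sum => [|a]; last first.
    by apply: bounded_measurableM => //; exact: bounded_measurable_cst.
  by apply: eq_bigr => a _; rewrite Rintegral_bmZ.
have SH a : \int (fun u => S u * H a u) = v * c a.
  under eq_Rintegral do rewrite mulrC.
  rewrite intg// (bigD1 a)//= big1 ?addr0; last first.
    by move=> b ba; rewrite orth eq_sym (negbTE ba) mulr0.
  by rewrite orth eqxx mulr1n mulrC.
have SS : \int (fun u => S u * S u) = v^-1 * \sum_a (\int (fun u => f u * H a u)) ^+ 2.
  rewrite intg// mulr_sumr; apply: eq_bigr => a _.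
  by rewrite SH /c [v * _]mulrA divff ?gt_eqF// mul1r expr2 mulrA.
have fS : \int (fun u => f u * S u) = \int (fun u => S u * S u).
  rewrite SS intg// mulr_sumr; apply: eq_bigr => a _.
  by rewrite /c expr2 !mulrA.
have : 0 <= \int (fun u => (f u - S u) ^+ 2).
  by apply: Rintegral_ge0 => u _; exact: sqr_ge0.
rewrite (_ : (fun u => (f u - S u) ^+ 2) =
  (fun u => f u ^+ 2 + (-2 * (f u * S u) + S u * S u))); last first.
  by apply/funext => u; ring.
have bff : bounded_measurable (fun u => f u ^+ 2) by exact: bounded_measurableM.
have bfS : bounded_measurable (fun u => f u * S u) by exact: bounded_measurableM.
have bSS : bounded_measurable (fun u => S u * S u) by exact: bounded_measurableM.
have b2fS : bounded_measurable (fun u => -2 * (f u * S u)).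
  by apply: bounded_measurableM => //; exact: bounded_measurable_cst.
rewrite Rintegral_bmD//; last exact: bounded_measurableD.
rewrite Rintegral_bmD// Rintegral_bmZ// fS SS.
lra.
Qed.

End bounded_measurable.

(** * Two hypotheses that cannot be told apart *)

Section two_point.
Context (R : realType) (d : nat).
Implicit Types p q : density R d.

(** Completing the square in [a]: the difference of the two sides is a sum of two
    squares in the square roots of [P] and [Q]. It bounds the cost of one number
    [a] estimating both [- s] and [s], without any test or Cauchy-Schwarz step. *)
Lemma two_point_pointwise (P Q a s : R) : 0 <= P -> 0 <= Q ->
  4 * s ^+ 2 * Num.sqrt (P * Q) <=
  (a + s) ^+ 2 * P + (a - s) ^+ 2 * Q + s ^+ 2 * (P + Q).
Proof.
move=> P0 Q0; rewrite sqrtrM//.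
have PE := sqr_sqrtr P0; have QE := sqr_sqrtr Q0; rewrite -{2 3}PE -{2 3}QE.
set x := Num.sqrt P; set y := Num.sqrt Q; rewrite -subr_ge0.
have -> : (a + s) ^+ 2 * x ^+ 2 + (a - s) ^+ 2 * y ^+ 2 +
    s ^+ 2 * (x ^+ 2 + y ^+ 2) - 4 * s ^+ 2 * (x * y) =
    2^-1 * (a * (x + y) + 2 * s * (x - y)) ^+ 2 + 2^-1 * (a * (x - y)) ^+ 2.
  by field.
by apply: addr_ge0; rewrite mulr_ge0// ?sqr_ge0 ?invr_ge0.
Qed.

Lemma bernoulli_inequality (h : R) n : 0 <= h <= 1 ->
  1 - n%:R * h <= (1 - h) ^+ n.
Proof.
move=> /andP[h0 h1]; elim: n => [|n IH]; first by rewrite mul0r subr0 expr0.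
rewrite exprS; apply: (@le_trans _ _ ((1 - h) * (1 - n%:R * h))).
  rewrite -natr1 -subr_ge0.
  have -> : (1 - h) * (1 - n%:R * h) - (1 - (n%:R + 1) * h) = n%:R * h ^+ 2.
    by ring.
  by rewrite mulr_ge0// sqr_ge0.
by apply: ler_wpM2l => //; rewrite subr_ge0.
Qed.

Lemma measurable_sqrt_pdfM p q :
  measurable_fun setT (fun u => Num.sqrt (p u * q u)).
Proof.
apply: measurableT_comp.
  by apply: continuous_measurable_fun; exact: sqrt_continuous.
by apply: measurable_funM; exact: measurable_pdf.
Qed.

(** An estimate [a] of a parameter that equals [- s] under [p] and [s] under [q] has
    total quadratic risk at least [s ^+ 2], as soon as [n] observations leave the
    Hellinger affinity of the product laws above [3 / 4]. The affinity of products
    is the product of the affinities, hence at least [(1 - h) ^+ n]. *)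
Lemma two_point p q n (a : n.-tuple (euclidean R d) -> R) (s h : R) :
  measurable_fun setT a -> 0 <= h <= 1 -> n%:R * h <= 4^-1 ->
  ((1 - h)%:E <= \int[lebesgue R d]_u (Num.sqrt (p u * q u))%:E)%E ->
  ((s ^+ 2)%:E <= \int[tuple_measure (law p) n]_x ((a x + s) ^+ 2)%:E +
                  \int[tuple_measure (law q) n]_x ((a x - s) ^+ 2)%:E)%E.
Proof.
move=> ma /andP[h0 h1] nh aff.
pose P (r : density R d) (x : n.-tuple (euclidean R d)) := \prod_i r (tnth x i).
have mP r : measurable_fun setT (P r).
  by apply: (@measurable_tuple_prod _ _ _ _ (fun=> r)) => i; exact: measurable_pdf.
have P0 r x : 0 <= P r x by apply: prodr_ge0 => i _; exact: pdf_ge0.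
have mplus : measurable_fun setT (fun x => (a x + s) ^+ 2).
  by apply: measurable_funX; exact: measurable_funD.
have mminus : measurable_fun setT (fun x => (a x - s) ^+ 2).
  by apply: measurable_funX; exact: measurable_funB.
have intP r : (\int[tuple_measure (lebesgue R d) n]_x (P r x)%:E = 1)%E.
  rewrite (integral_tuple_prod _ (f := fun=> r))//.
  - by rewrite big1// => i _; rewrite integral_pdf.
  - by move=> i; exact: measurable_pdf.
  - by move=> i u; exact: pdf_ge0.
have chg r (F : n.-tuple (euclidean R d) -> R) : measurable_fun setT F ->
    (forall x, 0 <= F x) ->
    (\int[tuple_measure (law r) n]_x (F x)%:E =
     \int[tuple_measure (lebesgue R d) n]_x (F x * P r x)%:E)%E.
  move=> mF F0; rewrite integral_tuple_law; last 2 first.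
  - exact/measurable_EFinP.
  - by move=> x; rewrite lee_fin.
  by apply: eq_integral => x _; rewrite EFinM.
rewrite chg//; last by move=> x; exact: sqr_ge0.
rewrite chg//; last by move=> x; exact: sqr_ge0.
have maffine : measurable_fun setT (fun u => Num.sqrt (p u * q u)).
  exact: measurable_sqrt_pdfM.
pose S (x : n.-tuple (euclidean R d)) := \prod_i Num.sqrt (p (tnth x i) * q (tnth x i)).
have mS : measurable_fun setT S.
  by apply: (@measurable_tuple_prod _ _ _ n (fun=> fun u => Num.sqrt (p u * q u))).
have S0 x : 0 <= S x by apply: prodr_ge0 => i _; exact: sqrtr_ge0.
have SE x : S x = Num.sqrt (P p x * P q x).
  rewrite /S /P -big_split/=.
  elim: (index_enum _) => [|i l IH]; first by rewrite !big_nil sqrtr1.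
  by rewrite !big_cons [RHS]sqrtrM ?mulr_ge0 ?pdf_ge0// IH.
have lower : ((1 - n%:R * h)%:E <= \int[tuple_measure (lebesgue R d) n]_x (S x)%:E)%E.
  rewrite (integral_tuple_prod _ (f := fun=> fun u => Num.sqrt (p u * q u)))//.
  apply: (@le_trans _ _ (\prod_(i < n) (1 - h)%:E)%E).
    rewrite prodEFin lee_fin prodr_const card_ord.
    by apply: bernoulli_inequality; rewrite h0.
  have h1' : (0 <= (1 - h)%:E)%E by rewrite lee_fin subr_ge0.
  elim: (index_enum _) => [|i l IH]; first by rewrite !big_nil.
  by rewrite !big_cons lee_pmul// prode_ge0.
have mZ r : measurable_fun setT (fun x => s ^+ 2 * P r x).
  exact: measurable_funM.
have mplusP : measurable_fun setT (fun x => (a x + s) ^+ 2 * P p x).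
  exact: measurable_funM.
have mminusP : measurable_fun setT (fun x => (a x - s) ^+ 2 * P q x).
  exact: measurable_funM.
have sqP0 r y x : 0 <= y ^+ 2 * P r x by rewrite mulr_ge0// sqr_ge0.
have intZ r : (\int[tuple_measure (lebesgue R d) n]_x (s ^+ 2 * P r x)%:E =
    (s ^+ 2)%:E)%E.
  by rewrite ge0_integralMl_real ?sqr_ge0// intP mule1.
have le : (\int[tuple_measure (lebesgue R d) n]_x (4 * s ^+ 2 * S x)%:E <=
  \int[tuple_measure (lebesgue R d) n]_x ((a x + s) ^+ 2 * P p x +
    (a x - s) ^+ 2 * P q x + (s ^+ 2 * P p x + s ^+ 2 * P q x))%:E)%E.
  apply: ge0_le_integral_real => [|x||x].
  - exact: measurable_funM.
  - by rewrite mulr_ge0// mulr_ge0// sqr_ge0.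
  - by apply: measurable_funD; apply: measurable_funD.
  - by rewrite SE -mulrDr; exact: two_point_pointwise.
have lhs : ((3 * s ^+ 2)%:E <=
    \int[tuple_measure (lebesgue R d) n]_x (4 * s ^+ 2 * S x)%:E)%E.
  have s40 : 0 <= 4 * s ^+ 2 by rewrite mulr_ge0// sqr_ge0.
  rewrite ge0_integralMl_real//.
  apply: (@le_trans _ _ ((4 * s ^+ 2)%:E * (1 - n%:R * h)%:E)%E); last first.
    by apply: lee_wpmul2l => //; rewrite lee_fin.
  rewrite -EFinM lee_fin; have := sqr_ge0 s; nra.
have DP0 x : 0 <= s ^+ 2 * P p x + s ^+ 2 * P q x by exact: addr_ge0.
have DF0 x : 0 <= (a x + s) ^+ 2 * P p x + (a x - s) ^+ 2 * P q x.
  exact: addr_ge0.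
have mDP : measurable_fun setT (fun x => s ^+ 2 * P p x + s ^+ 2 * P q x).
  exact: measurable_funD.
have mDF : measurable_fun setT
    (fun x => (a x + s) ^+ 2 * P p x + (a x - s) ^+ 2 * P q x).
  exact: measurable_funD.
rewrite !ge0_integralD_real// !intZ -EFinD in le.
have := le_trans lhs le.
rewrite -(@leeD2rE _ (s ^+ 2 + s ^+ 2)%:E (s ^+ 2)%:E)//; apply: le_trans.
by rewrite -EFinD lee_fin; lra.
Qed.

(** Away from zero the square root is Lipschitz, so the affinity is controlled by
    the [L2] distance of the densities:
    [2 * sqrt (p * q) = p + q - (sqrt p - sqrt q) ^+ 2], and the last square is at
    most [(p - q) ^+ 2 / (4 * lo)]. *)
Lemma affinity_ge p q (lo D : R) : 0 < lo ->
  (forall u, (p u = 0 /\ q u = 0) \/ (lo <= p u /\ lo <= q u)) ->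
  (\int[lebesgue R d]_u ((p u - q u) ^+ 2)%:E <= D%:E)%E ->
  ((1 - D / (8 * lo))%:E <= \int[lebesgue R d]_u (Num.sqrt (p u * q u))%:E)%E.
Proof.
move=> lo0 pq leD.
have mp := measurable_pdf p; have mq := measurable_pdf q.
have mpq : measurable_fun setT (fun u => (p u - q u) ^+ 2).
  by apply: measurable_funX; exact: measurable_funB.
have lo8 : 0 < 8 * lo by rewrite mulr_gt0.
have ms := measurable_sqrt_pdfM p q.
have D0 u : 0 <= (4 * lo)^-1 * (p u - q u) ^+ 2.
  by rewrite mulr_ge0 ?sqr_ge0// invr_ge0 mulr_ge0// ltW.
have lo4 : 0 <= (4 * lo)^-1 by rewrite invr_ge0 mulr_ge0// ltW.
have sq0 u : 0 <= Num.sqrt (p u * q u) by exact: sqrtr_ge0.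
have le : (\int[lebesgue R d]_u (p u + q u)%:E <=
    \int[lebesgue R d]_u (2 * Num.sqrt (p u * q u) +
       (4 * lo)^-1 * (p u - q u) ^+ 2)%:E)%E.
  apply: ge0_le_integral_real => [|u||u].
  - exact: measurable_funD.
  - by rewrite addr_ge0// pdf_ge0.
  - by apply: measurable_funD; apply: measurable_funM.
  -
    have [[-> ->]|[lp lq]] := pq u.
      by rewrite mul0r sqrtr0 subr0 expr0n/= !mulr0.
    have p0 := pdf_ge0 p u; have q0 := pdf_ge0 q u.
    rewrite sqrtrM//.
    have x0 := sqrtr_ge0 (p u); have y0 := sqrtr_ge0 (q u).
    have PE := sqr_sqrtr p0; have QE := sqr_sqrtr q0.
    set x := Num.sqrt (p u) in x0 PE *; set y := Num.sqrt (q u) in y0 QE *.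
    rewrite -PE -QE.
    rewrite -PE in lp; rewrite -QE in lq.
    have xy : 4 * lo <= (x + y) ^+ 2.
      have : lo <= x * y.
        have l2 : lo * lo <= x ^+ 2 * y ^+ 2 by apply: ler_pM => //; exact: ltW.
        have xy0 : 0 <= x * y by exact: mulr_ge0.
        by rewrite leNgt; apply/negP => xylo; nra.
      nra.
    have -> : (x ^+ 2 - y ^+ 2) ^+ 2 = (x + y) ^+ 2 * (x - y) ^+ 2 by ring.
    have l1 : (x - y) ^+ 2 <= (4 * lo)^-1 * ((x + y) ^+ 2 * (x - y) ^+ 2).
      rewrite mulrA; apply: ler_peMl; first exact: sqr_ge0.
      by rewrite mulrC ler_pdivlMr ?mul1r// mulr_gt0.
    apply: le_trans (lerD (lexx (2 * (x * y))) l1).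
    by rewrite le_eqVlt; apply/orP; left; apply/eqP; ring.
have ms2 : measurable_fun setT (fun u => 2 * Num.sqrt (p u * q u)).
  exact: measurable_funM.
have mD : measurable_fun setT (fun u => (4 * lo)^-1 * (p u - q u) ^+ 2).
  exact: measurable_funM.
have s20 u : 0 <= 2 * Num.sqrt (p u * q u) by rewrite mulr_ge0.
rewrite !ge0_integralD_real// ?integral_pdf in le; try exact: pdf_ge0.
have i1 : (\int[lebesgue R d]_u (2 * Num.sqrt (p u * q u))%:E =
    2%:E * \int[lebesgue R d]_u (Num.sqrt (p u * q u))%:E)%E.
  by rewrite ge0_integralMl_real.
have i2 : (\int[lebesgue R d]_u ((4 * lo)^-1 * (p u - q u) ^+ 2)%:E <=
    ((4 * lo)^-1 * D)%:E)%E.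
  rewrite ge0_integralMl_real//; last by move=> u; exact: sqr_ge0.
  by rewrite EFinM lee_wpmul2l// lee_fin.
have := le_trans le (leeD (le_refl _) i2); rewrite i1.
have : (0 <= \int[lebesgue R d]_u (Num.sqrt (p u * q u))%:E)%E.
  by apply: integral_ge0 => u _; rewrite lee_fin.
case: (integral _ _ _) => [r| |]//= _; last by rewrite leey.
  rewrite -!EFinM -!EFinD !lee_fin => h.
  have -> : D / (8 * lo) = 2^-1 * ((4 * lo)^-1 * D).
    by field; rewrite gt_eqF.
  lra.
Qed.

End two_point.

(** * Assouad's argument for the Hellinger loss *)

Section parametric_integral.
Context d1 d2 (X : measurableType d1) (T : measurableType d2) (R : realType).
Variables (mu : {sigma_finite_measure set T -> \bar R}) (K : set T).
Hypotheses (mK : measurable K) (muK : (mu K < +oo)%E).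

(** Adding the constant [c] makes the integrand nonnegative, and Tonelli's theorem
    then gives the measurability. *)
Lemma measurable_Rintegral_param (g : X * T -> R) (c : R) :
  measurable_fun setT g -> (forall z, `|g z| <= c) ->
  measurable_fun setT (fun x => Rintegral mu K (fun u => g (x, u))).
Proof.
move=> mg gc.
have bg x : bounded_measurable K (fun u => g (x, u)).
  split; last by exists c => u _; exact: gc.
  by apply: measurable_funTS; exact: measurableT_comp mg (measurable_pair1 x).
pose G (z : X * T) := (\1_K z.2 * (g z + c))%:E.
have -> : (fun x => Rintegral mu K (fun u => g (x, u))) =
    (fun x => fine (\int[mu]_u G (x, u)) + (- Rintegral mu K (fun=> c))).
  apply/funext => x; apply/esym/eqP; rewrite subr_eq; apply/eqP.
  rewrite -Rintegral_bmD//; last exact: bounded_measurable_cst.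
  rewrite /Rintegral integral_mkcond; congr fine; apply: eq_integral => u _.
  by rewrite /G patchE indicE /=; case: ifP => _; rewrite ?mul1r ?mul0r.
apply: measurable_funD => //.
apply: measurableT_comp; first exact: fine_measurable.
apply: (@measurable_fun_fubini_tonelli_F _ _ _ _ _ _ G).
  apply/measurable_EFinP; apply: measurable_funM; last exact: measurable_funD.
  by apply: (measurableT_comp _ measurable_snd); exact: measurable_indic.
move=> z; rewrite lee_fin mulr_ge0//.
by have := gc z; rewrite ler_norml => /andP[+ _]; lra.
Qed.

End parametric_integral.

(** An arbitrary estimate [q] may be clipped at an upper bound [hi] of the target:
    the clipped value is in a range where the square root has a slope bounded
    below, and clipping only brings it closer to [p]. *)
Lemma hellinger_pointwise (R : realType) (p q hi : R) : 0 <= p <= hi -> 0 < hi ->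
  0 <= q ->
  (4 * hi)^-1 * (p - Num.min q hi) ^+ 2 <= (Num.sqrt p - Num.sqrt q) ^+ 2.
Proof.
move=> /andP[p0 phi] hi0 q0; rewrite mulrC ler_pdivrMr ?mulr_gt0//.
have x0 := sqrtr_ge0 p; have y0 := sqrtr_ge0 q; have z0 := sqrtr_ge0 hi.
have PE := sqr_sqrtr p0; have QE := sqr_sqrtr q0.
have ZE := sqr_sqrtr (ltW hi0).
have xz : Num.sqrt p <= Num.sqrt hi by exact: ler_wsqrtr.
have [qhi|hiq] := leP q hi.
  have yz : Num.sqrt q <= Num.sqrt hi by exact: ler_wsqrtr.
  move: x0 y0 z0 PE QE ZE xz yz.
  move: (Num.sqrt p) (Num.sqrt q) (Num.sqrt hi) => x y z x0 y0 z0 <- <- <- xz yz.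
  have -> : (x ^+ 2 - y ^+ 2) ^+ 2 = (x - y) ^+ 2 * (x + y) ^+ 2 by ring.
  apply: ler_wpM2l; first exact: sqr_ge0.
  nra.
have yz : Num.sqrt hi <= Num.sqrt q by exact/ler_wsqrtr/ltW.
move: x0 y0 z0 PE QE ZE xz yz.
move: (Num.sqrt p) (Num.sqrt q) (Num.sqrt hi) => x y z x0 y0 z0 <- _ <- xz yz.
have -> : (x ^+ 2 - z ^+ 2) ^+ 2 = (x - z) ^+ 2 * (x + z) ^+ 2 by ring.
by apply: ler_pM; rewrite ?sqr_ge0//; nra.
Qed.

(** The densities [p s] are indexed by the vertices of a hypercube and differ from
    a centre [p0] by signed multiples of orthogonal functions [H a]. Estimating
    [p s] then means estimating every sign [s a] separately. *)
Section assouad.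
Context (R : realType) (d : nat) (K : set (euclidean R d)) (A : finType).
Local Notation mu := (lebesgue R d).
Local Notation E := (euclidean R d).
Hypotheses (mK : measurable K) (muK : (mu K < +oo)%E).
Hypothesis (Korthant : K `<=` @orthant R d).
Variables (H : A -> E -> R) (p : {ffun A -> bool} -> density R d) (p0 : E -> R).
Variables (e v lo hi : R).
Hypotheses (v0 : 0 < v) (lo0 : 0 < lo) (hi0 : 0 < hi).
Hypothesis bp0 : bounded_measurable K p0.
Hypothesis mH : forall a, measurable_fun setT (H a).
Hypothesis Hbnd : exists c, forall a u, `|H a u| <= c.
Hypothesis HK : forall a u, ~ K u -> H a u = 0.
Hypothesis Horth : forall a b,
  Rintegral mu K (fun u => H a u * H b u) = v *+ (a == b).
Hypothesis pE : forall s u, K u ->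
  p s u = p0 u + e * \sum_a (-1) ^+ s a * H a u.
Hypothesis pK : forall s u, K u -> lo <= p s u <= hi.
Hypothesis pKC : forall s u, ~ K u -> p s u = 0.

Let bH a : bounded_measurable K (H a).
Proof.
split; first exact: measurable_funTS.
by have [c Hc] := Hbnd; exists c => u _.
Qed.

Lemma measurable_orthant : measurable (@orthant R d).
Proof.
have -> : @orthant R d =
    \bigcap_(j in [set: 'I_d]) ((fun u => tnth u j) @^-1` `]0, +oo[).
  apply/seteqP; split => u /= h j; first by move=> _ /=; rewrite in_itv/= h.
  by have := h j I; rewrite /= in_itv/= andbT.
apply: fin_bigcap_measurable => // j _.
by rewrite -[X in measurable X]setTI; apply: measurable_tnth.
Qed.

Lemma hellinger2_bessel s (q : E -> R) : measurable_fun setT q ->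
  (forall u, 0 <= q u) ->
  (((4 * hi)^-1 * (v^-1 * \sum_a
      (Rintegral mu K (fun u => (p s u - Num.min (q u) hi) * H a u)) ^+ 2))%:E
   <= hellinger2 (p s) q)%E.
Proof.
move=> mq q0.
have mp := measurable_pdf (p s).
have mmin : measurable_fun setT (fun u => p s u - Num.min (q u) hi).
  by apply: measurable_funB => //; exact: measurable_minr.
have bf : bounded_measurable K (fun u => p s u - Num.min (q u) hi).
  split; first exact: measurable_funTS.
  exists (hi + hi) => u Ku; rewrite (le_trans (ler_normB _ _))//.
  have /andP[_ phi] := pK s Ku.
  have min0 : 0 <= Num.min (q u) hi by rewrite le_min q0 ltW.
  by rewrite !ger0_norm ?pdf_ge0// lerD// ge_min lexx orbT.
have bf2 := bounded_measurableM bf bf.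
apply: (@le_trans _ _ (\int[mu]_(u in K)
    ((4 * hi)^-1 * (p s u - Num.min (q u) hi) ^+ 2)%:E)%E).
  have b1 : bounded_measurable K
      (fun u => (4 * hi)^-1 * (p s u - Num.min (q u) hi) ^+ 2).
    by apply: bounded_measurableM => //; exact: bounded_measurable_cst.
  rewrite -[leRHS]fineK; last first.
    exact/integrable_fin_num/(bounded_measurable_integrable mK muK b1).
  rewrite lee_fin -/(Rintegral mu K _) (Rintegral_bmZ mK muK)//.
  apply: ler_wpM2l; first by rewrite invr_ge0 mulr_ge0// ltW.
  exact: (bessel mK muK).
have mh : measurable_fun setT (fun u => (Num.sqrt (p s u) - Num.sqrt (q u)) ^+ 2).
  apply: measurable_funX; apply: measurable_funB;
    apply: measurableT_comp => //; apply: continuous_measurable_fun;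
    exact: sqrt_continuous.
apply: (@le_trans _ _ (\int[mu]_(u in K)
   ((Num.sqrt (p s u) - Num.sqrt (q u)) ^+ 2)%:E)%E); last first.
  apply: ge0_subset_integral => //; first exact: measurable_orthant.
    by apply/measurable_EFinP; exact: measurable_funTS.
  by move=> u _; rewrite lee_fin sqr_ge0.
apply: ge0_le_integral => //.
- by move=> u _; rewrite lee_fin mulr_ge0 ?sqr_ge0// invr_ge0 mulr_ge0// ltW.
- apply/measurable_EFinP; apply: measurable_funTS; apply: measurable_funM => //.
  exact: measurable_funX.
- by apply/measurable_EFinP; exact: measurable_funTS.
- move=> u Ku; rewrite lee_fin; apply: hellinger_pointwise => //.
  by have /andP[lp ph] := pK s Ku; rewrite ph pdf_ge0.
Qed.

Let bmin (q : E -> R) : measurable_fun setT q -> (forall u, 0 <= q u) ->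
  bounded_measurable K (fun u => Num.min (q u) hi).
Proof.
move=> mq q0; split; first by apply: measurable_funTS; exact: measurable_minr.
exists hi => u _; rewrite ger0_norm ?ge_min ?lexx ?orbT//.
by rewrite le_min q0 ltW.
Qed.

(** By orthogonality the [a]-th coefficient of the error depends on the parameter
    only through the sign [s a]. *)
Lemma hypercube_coefficient s a (q : E -> R) :
  measurable_fun setT q -> (forall u, 0 <= q u) ->
  Rintegral mu K (fun u => (p s u - Num.min (q u) hi) * H a u) =
  Rintegral mu K (fun u => (p0 u - Num.min (q u) hi) * H a u) +
  e * v * (-1) ^+ s a.
Proof.
move=> mq q0; have bq := bmin mq q0.
pose c b := e * (-1) ^+ s b.
have bcst r : bounded_measurable K (fun=> r) by exact: bounded_measurable_cst.
have bHH b : bounded_measurable K (fun u => H b u * H a u).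
  exact: bounded_measurableM.
transitivity (Rintegral mu K (fun u => (p0 u - Num.min (q u) hi) * H a u +
    \sum_b c b * (H b u * H a u))).
  apply: eq_Rintegral => u /[!inE] Ku; rewrite pE// addrAC mulrDl; congr (_ + _).
  rewrite mulr_sumr mulr_suml; apply: eq_bigr => b _.
  by rewrite /c !mulrA.
rewrite (Rintegral_bmD mK muK); last 2 first.
- apply: bounded_measurableM => //; apply: bounded_measurableD => //.
  under eq_fun do rewrite -mulN1r.
  exact: bounded_measurableM.
- by apply: bounded_measurable_sum => // b; exact: bounded_measurableM.
congr (_ + _).
rewrite (Rintegral_bm_sum mK muK); last by move=> b; exact: bounded_measurableM.
rewrite (bigD1 a)//= big1 ?addr0 => [|b ba].
  by rewrite (Rintegral_bmZ mK muK)// Horth eqxx mulr1n /c mulrAC.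
by rewrite (Rintegral_bmZ mK muK)// Horth (negbTE ba) mulr0.
Qed.

Lemma measurable_hellinger2 n (r : density R d) (q : n.-tuple E -> E -> R) :
  estimator q -> measurable_fun setT (fun x => hellinger2 r (q x)).
Proof.
move=> [mq _].
pose F (z : n.-tuple E * E) :=
  (\1_(@orthant R d) z.2 * (Num.sqrt (r z.2) - Num.sqrt (q z.1 z.2)) ^+ 2)%:E.
have -> : (fun x => hellinger2 r (q x)) = (fun x => \int[mu]_u F (x, u))%E.
  apply/funext => x; rewrite /hellinger2 integral_mkcond.
  apply: eq_integral => u _.
  by rewrite patchE /F indicE/=; case: ifP => _; rewrite ?mul1r ?mul0r.
apply: measurable_fun_fubini_tonelli_F.
  apply/measurable_EFinP; apply: measurable_funM.
    apply: (measurableT_comp _ measurable_snd).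
    by apply: measurable_indic; exact: measurable_orthant.
  have msqrt := continuous_measurable_fun (@sqrt_continuous R).
  apply: measurable_funX; apply: measurable_funB.
    apply: (measurableT_comp msqrt).
    exact: measurableT_comp (measurable_pdf r) measurable_snd.
  exact: measurableT_comp msqrt mq.
by move=> z; rewrite lee_fin mulr_ge0// sqr_ge0.
Qed.

Definition flip (a : A) (s : {ffun A -> bool}) : {ffun A -> bool} :=
  [ffun b => if b == a then ~~ s b else s b].

Lemma flipK a : involutive (flip a).
Proof.
by move=> s; apply/ffunP => b; rewrite !ffunE; case: eqP => // _; rewrite negbK.
Qed.

(** Neighbouring vertices differ by [2 * e * H a] up to sign, so their squared [L2]
    distance is [4 * e ^+ 2 * v]. *)
Lemma flip_affinity a s :
  ((1 - e ^+ 2 * v / (2 * lo))%:E <=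
   \int[mu]_u (Num.sqrt (p s u * p (flip a s) u))%:E)%E.
Proof.
have := @affinity_ge R d (p s) (p (flip a s)) lo (4 * e ^+ 2 * v) lo0.
have -> : 4 * e ^+ 2 * v / (8 * lo) = e ^+ 2 * v / (2 * lo).
  by field; rewrite gt_eqF.
apply=> [u|].
  have [Ku|nKu] := pselect (K u); last by left; rewrite !pKC.
  by right; have /andP[-> _] := pK s Ku; have /andP[-> _] := pK (flip a s) Ku.
have dE u : (p s u - p (flip a s) u) ^+ 2 = 4 * e ^+ 2 * (H a u * H a u).
  have [Ku|nKu] := pselect (K u); last first.
    by rewrite !pKC// HK// subrr expr0n/= !mulr0.
  rewrite !pE// opprD addrACA subrr add0r -mulrBr -sumrB (bigD1 a)//= big1 => [|b ba].
    by rewrite addr0 ffunE eqxx; case: (s a); rewrite /= ?expr1 ?expr0; ring.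
  by rewrite ffunE (negbTE ba) subrr.
have bHH : bounded_measurable K (fun u => H a u * H a u).
  exact: bounded_measurableM.
under eq_integral do rewrite dE.
rewrite ge0_integralMl_real//; last 3 first.
- exact: measurable_funM.
- by move=> u; rewrite -expr2 sqr_ge0.
- by rewrite mulr_ge0// sqr_ge0.
rewrite [leRHS]EFinM; apply: lee_wpmul2l; first by rewrite lee_fin mulr_ge0// sqr_ge0.
have -> : v = Rintegral mu K (fun u => H a u * H a u) by rewrite Horth eqxx.
rewrite fineK; last first.
  exact/integrable_fin_num/(bounded_measurable_integrable mK muK bHH).
rewrite [leRHS]integral_mkcond.
rewrite le_eqVlt; apply/orP; left; apply/eqP; apply: eq_integral => u _.
by rewrite patchE; case: ifPn => //; rewrite notin_setE => nKu; rewrite HK// mul0r.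
Qed.

(** The Bessel inequality bounds the loss below by a sum over [a] of squared errors
    of estimation of [e * v * (-1) ^+ s a]. For each [a], pair the vertex [s] with
    its neighbour [flip a s] and apply the two-point bound; the pairs contribute
    [(e * v) ^+ 2] each. *)
Lemma assouad n (q : n.-tuple E -> E -> R) : (0 < n)%N ->
  n%:R * (e ^+ 2 * v / (2 * lo)) <= 4^-1 -> estimator q ->
  ((#|{: {ffun A -> bool}}|%:R * (#|A|%:R * e ^+ 2 * v / (8 * hi)))%:E <=
   \sum_s risk (p s) q)%E.
Proof.
move=> n0 nh [mq q0].
set h := e ^+ 2 * v / (2 * lo) in nh.
have h0 : 0 <= h.
  apply: divr_ge0; apply: mulr_ge0 => //; try exact: ltW.
  exact: sqr_ge0.
have h1 : h <= 1.
  have : 1 * h <= n%:R * h by rewrite ler_wpM2r// ler1n.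
  by rewrite mul1r; lra.
have mqx x : measurable_fun setT (q x).
  exact: measurableT_comp mq (measurable_pair1 x).
pose coef a x := Rintegral mu K (fun u => (p0 u - Num.min (q x u) hi) * H a u).
have mcoef a : measurable_fun setT (coef a).
  pose g (z : n.-tuple E * E) := Num.min (q z.1 z.2) hi * H a z.2.
  have mg : measurable_fun setT g.
    apply: measurable_funM; first exact: measurable_minr.
    exact: measurableT_comp.
  have [c Hc] := Hbnd.
  have gc z : `|g z| <= hi * c.
    rewrite normrM ler_pM// ger0_norm ?ge_min ?lexx ?orbT//.
    by rewrite le_min q0 ltW.
  have -> : coef a = (fun x => Rintegral mu K (fun u => p0 u * H a u) +
      -1 * Rintegral mu K (fun u => g (x, u))).
    apply/funext => x; have bq := bmin (mqx x) (q0 x).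
    rewrite -(Rintegral_bmZ mK muK) -?(Rintegral_bmD mK muK).
    - by apply: eq_Rintegral => u _; rewrite /g; ring.
    - exact: bounded_measurableM.
    - apply: bounded_measurableM; first exact: bounded_measurable_cst.
      exact: bounded_measurableM.
    - exact: bounded_measurableM.
  apply: measurable_funD => //; apply: measurable_funM => //.
  exact: measurable_Rintegral_param mg gc.
pose I (s : {ffun A -> bool}) a := (\int[tuple_measure (law (p s)) n]_x
  ((coef a x + e * v * (-1) ^+ s a) ^+ 2)%:E)%E.
have I0 s a : (0 <= I s a)%E.
  by apply: integral_ge0 => x _; rewrite lee_fin sqr_ge0.
have mI (s : {ffun A -> bool}) a :
    measurable_fun setT (fun x => (coef a x + e * v * (-1) ^+ s a) ^+ 2).
  by apply: measurable_funX; exact: measurable_funD.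
pose k := (4 * hi)^-1 * v^-1.
have k0 : 0 <= k by rewrite mulr_ge0// invr_ge0 ?mulr_ge0// ltW.
have risk_ge s : (k%:E * \sum_a I s a <= risk (p s) q)%E.
  have -> : (k%:E * \sum_a I s a = \int[tuple_measure (law (p s)) n]_x
      (k * \sum_a (coef a x + e * v * (-1) ^+ s a) ^+ 2)%:E)%E.
    rewrite ge0_integralMl_real//; last 2 first.
    - by apply: measurable_sum => a; exact: mI.
    - by move=> x; apply: sumr_ge0 => a _; exact: sqr_ge0.
    congr (_ * _)%E; under [RHS]eq_integral do rewrite -sumEFin.
    rewrite ge0_integral_sum// => [a|a x _]; first exact/measurable_EFinP.
    by rewrite lee_fin sqr_ge0.
  rewrite /risk; apply: ge0_le_integral => //.
  - move=> x _; rewrite lee_fin mulr_ge0//.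
    by apply: sumr_ge0 => a _; exact: sqr_ge0.
  - apply/measurable_EFinP; apply: measurable_funM => //.
    by apply: measurable_sum => a; exact: mI.
  - exact: measurable_hellinger2.
  - move=> x _; apply: le_trans (hellinger2_bessel s (mqx x) (q0 x)).
    rewrite lee_fin /k -[leLHS]mulrA; apply: ler_wpM2l.
      by rewrite invr_ge0 mulr_ge0// ltW.
    apply: ler_wpM2l; first by rewrite invr_ge0 ltW.
    by apply: ler_sum => a _; rewrite hypercube_coefficient.
have pair s a : (((e * v) ^+ 2)%:E <= I s a + I (flip a s) a)%E.
  have := @two_point R d (p s) (p (flip a s)) n (coef a) (e * v * (-1) ^+ s a) h
    (mcoef a).
  rewrite h0 h1 => /(_ isT nh (flip_affinity a s)).
  rewrite exprMn sqrr_sign mulr1 => /le_trans; apply.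
  rewrite /I; apply: leeD; apply: ge0_le_integral_real => //.
  - by move=> x; exact: sqr_ge0.
  - by apply: measurable_funX; exact: measurable_funB.
  - by move=> x; exact: sqr_ge0.
  - move=> x; rewrite ffunE eqxx -mulrN.
    by case: (s a); rewrite /= ?expr0 ?expr1 ?opprK.
have sumI a : ((#|{: {ffun A -> bool}}|%:R * ((e * v) ^+ 2 / 2))%:E <=
    \sum_s I s a)%E.
  have : (\sum_(s : {ffun A -> bool}) ((e * v) ^+ 2)%:E <=
      \sum_s I s a + \sum_s I s a)%E.
    rewrite [X in (_ <= _ + X)%E](reindex_inj (inv_inj (flipK a))) -big_split/=.
    by apply: lee_sum => s _; exact: pair.
  (* every unordered pair is counted twice, whence the factor 2 *)
  rewrite sumEFin sumr_const.
  have : (0 <= \sum_s I s a)%E by apply: sume_ge0 => s _; exact: I0.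
  case: (\sum_s I s a)%E => [y| |]// _; last by move=> _; rewrite leey.
  rewrite -EFinD !lee_fin -mulr_natl; lra.
have kE : #|A|%:R * e ^+ 2 * v / (8 * hi) = k * (#|A|%:R * ((e * v) ^+ 2 / 2)).
  by rewrite /k; field; rewrite !gt_eqF.
apply: (@le_trans _ _ (\sum_s (k%:E * \sum_a I s a))%E); last exact: lee_sum.
rewrite -ge0_sume_distrr; last by move=> s _; apply: sume_ge0 => a _; exact: I0.
rewrite exchange_big/= kE mulrCA EFinM; apply: lee_wpmul2l; first by rewrite lee_fin.
apply: (@le_trans _ _ (\sum_(a : A)
    (#|{: {ffun A -> bool}}|%:R * ((e * v) ^+ 2 / 2))%:E)%E).
  by rewrite sumEFin sumr_const -[X in (_ <= X%:E)%E]mulr_natl mulrCA.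
by apply: lee_sum => a _.
Qed.

End assouad.

(** * Positive combinations of boxes are scale mixtures of uniforms *)

Section boxes.
Context (R : realType).

(** The interval is open at [0] so that [ind 0] vanishes and densities built from
    boxes are zero outside the open orthant. *)
Definition ind (t x : R) : R := \1_(`]0, t]) x.

Lemma measurable_ind t : measurable_fun setT (ind t).
Proof. exact: measurable_indic. Qed.

Lemma ind_ge0 t x : 0 <= ind t x.
Proof. by rewrite /ind indicE. Qed.

Lemma ind_le1 t x : ind t x <= 1.
Proof. by rewrite /ind indicE; case: (_ \in _). Qed.

Lemma indE t x : ind t x = ((0 < x) && (x <= t))%:R.
Proof. by rewrite /ind indicE mem_setE in_itv. Qed.

Lemma indM s t x : ind s x * ind t x = ind (Num.min s t) x.
Proof. by rewrite !indE le_min -natrM mulnb andbACA andbb. Qed.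

Lemma integral_ind t : 0 <= t ->
  (\int[@lebesgue_measure R]_x (ind t x)%:E = t%:E)%E.
Proof.
move=> t0; rewrite /ind integral_indic//= setIT lebesgue_measure_itv/= lte_fin.
by case: ltP => [_|t0']; rewrite ?sube0//; congr EFin; apply/eqP; rewrite eq_le t0 t0'.
Qed.

Variable d : nat.
Implicit Types (tau : 'I_d -> R) (u : euclidean R d).

Definition box tau u : R := \prod_j ind (tau j) (tnth u j).

Lemma measurable_box tau : measurable_fun setT (box tau).
Proof.
apply: (@measurable_tuple_prod _ _ _ d (fun j => ind (tau j))) => j.
exact: measurable_ind.
Qed.

Lemma box_ge0 tau u : 0 <= box tau u.
Proof. by apply: prodr_ge0 => j _; exact: ind_ge0. Qed.

Lemma box_le1 tau u : box tau u <= 1.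
Proof. by apply: prodr_ile1 => j _; rewrite ind_ge0 ind_le1. Qed.

Lemma boxE tau u : box tau u = [forall j, (0 < tnth u j) && (tnth u j <= tau j)]%:R.
Proof.
rewrite /box; case: (boolP [forall j, _]) => [/forallP h|].
  by rewrite big1// => j _; rewrite indE h.
rewrite negb_forall => /existsP[j /negbTE hj].
by rewrite (bigD1 j)//= indE hj mul0r.
Qed.

Lemma box_out tau u : ~ orthant u -> box tau u = 0.
Proof.
move=> nu; rewrite boxE; case: forallP => // h; exfalso; apply: nu => j.
by have /andP[] := h j.
Qed.

Lemma integral_box tau : (forall j, 0 <= tau j) ->
  (\int[lebesgue R d]_u (box tau u)%:E = (\prod_j tau j)%:E)%E.
Proof.
move=> tau0.
apply: etrans (integral_tuple_prod (@lebesgue_measure R)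
  (fun j => measurable_ind (tau j)) (fun j x => ind_ge0 (tau j) x)) _.
by rewrite -prodEFin; apply: eq_bigr => j _; rewrite integral_ind.
Qed.

Lemma box_orthant tau u : orthant u ->
  box tau u = \prod_j (tnth u j <= tau j)%R%:R.
Proof. by move=> ou; apply: eq_bigr => j _; rewrite indE ou. Qed.

End boxes.

Section box_mixture.
Context (R : realType) (d : nat) (I : finType).
Variables (w : I -> R) (tau : I -> 'I_d -> R).
Hypotheses (w0 : forall i, 0 <= w i) (tau0 : forall i j, 0 <= tau i j).
Hypothesis sum1 : \sum_i w i * \prod_j tau i j = 1.

Definition box_mixture_pdf (u : euclidean R d) : R := \sum_i w i * box (tau i) u.

Let measurable_box_mixture : measurable_fun setT box_mixture_pdf.
Proof.
by apply: measurable_sum => i; apply: measurable_funM => //; exact: measurable_box.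
Qed.

Let box_mixture_ge0 u : 0 <= box_mixture_pdf u.
Proof. by apply: sumr_ge0 => i _; rewrite mulr_ge0// box_ge0. Qed.

Let box_mixture_out u : ~ orthant u -> box_mixture_pdf u = 0.
Proof.
by move=> nu; rewrite /box_mixture_pdf big1// => i _; rewrite box_out// mulr0.
Qed.

Let integral_box_mixture : (\int[lebesgue R d]_u (box_mixture_pdf u)%:E = 1)%E.
Proof.
under eq_integral do rewrite /box_mixture_pdf -sumEFin.
rewrite ge0_integral_sum//; last 2 first.
- move=> i; apply/measurable_EFinP; apply: measurable_funM => //.
  exact: measurable_box.
- by move=> i u _; rewrite lee_fin mulr_ge0// box_ge0.
rewrite -sum1 -sumEFin; apply: eq_bigr => i _.
rewrite ge0_integralMl_real ?integral_box//; first exact: measurable_box.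
exact: box_ge0.
Qed.

Definition box_mixture : density R d :=
  Density measurable_box_mixture box_mixture_ge0 box_mixture_out
    integral_box_mixture.

Let W i := w i * \prod_j tau i j.
Let W0 i : 0 <= W i.
Proof. by rewrite mulr_ge0// prodr_ge0. Qed.

Let x i : euclidean R d := [tuple tau i j | j < d].

(** The mixing measure, with mass [W i] at the upper corner of the [i]-th box. A
    corner with a zero coordinate is outside the open orthant, but its mass is
    zero as well. *)
Let m_ (k : nat) : {measure set (euclidean R d) -> \bar R} :=
  if insub k is Some o then
    mscale (NngNum (W0 (enum_val (o : 'I_#|I|)))) (dirac (x (enum_val o)))
  else mzero.

Let integral_atoms (D : set (euclidean R d)) (f : euclidean R d -> \bar R) :
  measurable D -> measurable_fun D f -> (forall u, D u -> 0 <= f u)%E ->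
  (\int[msum m_ #|I|]_(u in D) f u =
   \sum_i (W i)%:E * (\d_(x i) D * f (x i)))%E.
Proof.
move=> mD mf f0; rewrite ge0_integral_measure_sum// [RHS]big_enum_val/=.
apply: eq_bigr => k _; rewrite /m_ valK.
by rewrite ge0_integral_mscale//= integral_dirac.
Qed.

Let orthantP i : (\d_(x i) (@orthant R d) = ([forall j, (0 < tau i j)%R]%:R : R)%:E)%E.
Proof.
rewrite diracE; congr (nat_of_bool _)%:R%:E.
apply/idP/forallP => [|h]; rewrite in_setE.
  by move=> h j; have := h j; rewrite tnth_mktuple.
by move=> j; rewrite tnth_mktuple.
Qed.

Let atom_orthant i : (W i)%:E = ((W i)%:E * \d_(x i) (@orthant R d))%E.
Proof.
rewrite orthantP; case: forallP => [_|/forallP]; first by rewrite mule1.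
rewrite negb_forall => /existsP[j]; rewrite -leNgt => tj.
have tj0 : tau i j = 0 by apply/eqP; rewrite eq_le tj tau0.
by rewrite /W (bigD1 j)//= tj0 mul0r mulr0 mule0.
Qed.

(** Against the atom at [tau i] the uniform kernel is the box divided by its volume,
    and the mass [W i] restores the factor [w i]. *)
Lemma box_mixture_SMU : is_SMU box_mixture.
Proof.
have sumW : (\sum_i (W i)%:E = 1)%E by rewrite sumEFin sum1.
have atomsE (D : set (euclidean R d)) : measurable D ->
    (msum m_ #|I| D = \sum_i (W i)%:E * \d_(x i) D)%E.
  move=> mD; rewrite -[LHS]mul1e -(@integral_cst _ _ _ (msum m_ #|I|))//.
  by rewrite integral_atoms//; apply: eq_bigr => i _; rewrite mule1.
have muT : msum m_ #|I| setT = 1%E.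
  by rewrite atomsE// -sumW; apply: eq_bigr => i _; rewrite diracT mule1.
pose G : probability (euclidean R d) R :=
  HB.pack (msum m_ #|I|) (@Measure_isProbability.Build _ _ _ (msum m_ #|I|) muT).
have mO := @measurable_orthant R d.
exists G => [|u ou].
  rewrite /G/= atomsE// -sumW; apply: eq_bigr => i _.
  by rewrite -atom_orthant.
rewrite /uniform_scale_mixture.
pose k (theta : euclidean R d) :=
  \prod_(j < d) (\1_(`[tnth u j, +oo[) (tnth theta j) * (tnth theta j) `^ (-1)) : R.
have kE theta : orthant theta ->
    \prod_(j < d) ((tnth u j <= tnth theta j)%R%:R / tnth theta j) = k theta.
  move=> oth; apply: eq_bigr => j _; rewrite indicE mem_setE in_itv/= andbT.
  by rewrite powR_inv1// ltW.
rewrite (eq_integral (fun theta => (k theta)%:E)); last first.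
  by move=> theta /[!inE] oth; rewrite kE.
rewrite /G/= integral_atoms//; last 2 first.
- apply/measurable_EFinP; apply: measurable_funTS.
  apply: (@measurable_tuple_prod _ _ _ d
    (fun j y => \1_(`[tnth u j, +oo[) y * y `^ (-1))) => j.
  by apply: measurable_funM; [exact: measurable_indic|exact: measurable_powR].
- move=> theta oth; rewrite lee_fin prodr_ge0// => j _.
  by rewrite mulr_ge0// ?powR_ge0// indicE.
rewrite -sumEFin; apply: eq_bigr => i _.
rewrite muleA -atom_orthant -EFinM; congr EFin.
have [/forallP h|] := boolP [forall j, 0 < tau i j].
  rewrite -kE => [|j]; last by rewrite tnth_mktuple.
  rewrite /W -mulrA; congr (_ * _); rewrite -big_split/= box_orthant//.
  apply: eq_bigr => j _; rewrite tnth_mktuple mulrCA divff ?mulr1//.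
  by rewrite gt_eqF.
rewrite negb_forall => /existsP[j]; rewrite -leNgt => tj.
have tj0 : tau i j = 0 by apply/eqP; rewrite eq_le tj tau0.
rewrite /W [in RHS](bigD1 j)//= tj0 mul0r mulr0 mul0r.
by rewrite box_orthant// (bigD1 j)//= tj0 leNgt ou mul0r mulr0.
Qed.

End box_mixture.

(** * The Haar system on an interval *)

Section haar_line.
Context (R : realType) (M : R).
Hypothesis M0 : 0 < M.

(** The Haar function of the dyadic interval with end points [a], [c] and midpoint
    [b] is [- ind a + 2 * ind b - ind c]: equal to [1] on the first half and to [-1]
    on the second. *)
Definition haar_coef (c : 'I_3) : R := if c == 1%N :> nat then 2 else -1.

(** For [c = 0, 1, 2]: left end, midpoint and right end of the [i]-th dyadic interval
    of level [m] in [(0, M]]. *)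
Definition node (m i : nat) (c : 'I_3) : R := M * (2 * i + c)%:R / 2 ^+ m.+1.

(** The inner product of two Haar functions, since the integral of
    [ind s * ind t] is the minimum of [s] and [t]. *)
Definition node_gram (m i m' i' : nat) : R :=
  \sum_c \sum_c' haar_coef c * haar_coef c' * Num.min (node m i c) (node m' i' c').

Lemma sum3 (F : 'I_3 -> R) :
  \sum_c F c = F ord0 + F (Ordinal (isT : (1 < 3)%N)) + F (Ordinal (isT : (2 < 3)%N)).
Proof.
rewrite !big_ord_recl big_ord0 addr0 addrA.
by congr (_ + F _ + F _); apply: val_inj.
Qed.

Lemma sum_haar_coef : \sum_c haar_coef c = 0.
Proof. by rewrite sum3 /haar_coef /=; ring. Qed.

Lemma sum_norm_haar_coef : \sum_c `|haar_coef c| = 4.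
Proof. by rewrite sum3 /haar_coef /= !normrN normr1 ger0_norm//; ring. Qed.

Lemma node_ge0 m i c : 0 <= node m i c.
Proof.
by apply: divr_ge0; [apply: mulr_ge0 => //; exact: ltW|exact: exprn_ge0].
Qed.

Lemma node_leM m i c : (i < 2 ^ m)%N -> node m i c <= M.
Proof.
move=> im; rewrite /node ler_pdivrMr ?exprn_gt0// ler_pM2l//.
rewrite -natrX ler_nat expnS; have := ltn_ord c; lia.
Qed.

Lemma node_mono m i (c c' : 'I_3) : (c <= c')%N -> node m i c <= node m i c'.
Proof.
move=> cc'; rewrite /node ler_pM2r ?invr_gt0 ?exprn_gt0// ler_pM2l// ler_nat.
by rewrite leq_add2l.
Qed.

Lemma sum_haar_node m i : \sum_c haar_coef c * node m i c = 0.
Proof.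
rewrite sum3 /haar_coef /node !(natrD _ (2 * i)) natrM /=; field.
by rewrite expf_neq0.
Qed.

(** A second difference with equal steps kills affine functions, and
    [y |-> min x y] is affine on any interval that does not contain [x] in its
    interior. *)
Lemma min_outside x m i : x <= node m i ord0 \/ node m i ord_max <= x ->
  \sum_c haar_coef c * Num.min x (node m i c) = 0.
Proof.
case=> h.
  under eq_bigr => c _ do rewrite (min_idPl _) ?(le_trans h (node_mono _ _ _))//.
  by rewrite -mulr_suml sum_haar_coef mul0r.
rewrite -[RHS](sum_haar_node m i); apply: eq_bigr => c _.
by rewrite (min_idPr _)// (le_trans (node_mono _ _ _) h)// -ltnS.
Qed.

Lemma node_gramC m i m' i' : node_gram m i m' i' = node_gram m' i' m i.
Proof.
rewrite /node_gram exchange_big; apply: eq_bigr => c _; apply: eq_bigr => c' _.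
by rewrite minC [haar_coef _ * _]mulrC.
Qed.

Lemma node_gram_diag m i : node_gram m i m i = M / 2 ^+ m.
Proof.
rewrite /node_gram; under eq_bigr => c _ do under eq_bigr => c' _ do rewrite -mulrA.
under eq_bigr => c _ do rewrite -mulr_sumr.
pose mid : 'I_3 := Ordinal (isT : (1 < 3)%N).
rewrite [LHS](bigD1 mid)//= [X in _ + X]big1 ?addr0 => [|c cmid]; last first.
  rewrite min_outside ?mulr0//; move: c cmid => [[|[|[|//]]] c3]// _.
  - by left; apply: node_mono.
  - by right; apply: node_mono.
rewrite sum3.
rewrite (min_idPr _) ?node_mono// minxx (min_idPl _) ?node_mono//.
rewrite /haar_coef /node !(natrD _ (2 * i)) natrM exprS /=; field.
by rewrite expf_neq0.
Qed.

(** No node of the coarser interval lies inside the finer one; at equal levels the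
    two intervals do not overlap. *)
Lemma node_gram_level m m' i i' : (m <= m')%N -> (m, i) != (m', i') ->
  node_gram m i m' i' = 0.
Proof.
move=> mm' neq; rewrite /node_gram big1// => c _.
under eq_bigr => c' _ do rewrite -mulrA.
rewrite -mulr_sumr min_outside ?mulr0//.
(* In units of half the finer mesh all nodes are integers, and those of the
   coarser level are multiples of [s]. *)
pose s := (2 ^ (m' - m))%N.
have nodeE : node m i c = M * ((2 * i + c) * s)%:R / 2 ^+ m'.+1.
  rewrite /node -(subnK mm') -addnS exprD natrM -/s /s natrX; field.
  by rewrite !expf_neq0.
have cmp : ((2 * i + c) * s <= 2 * i')%N || (2 * i' + 2 <= (2 * i + c) * s)%N.
  have c2 : (c < 3)%N by exact: ltn_ord.
  have [mE|mN] := eqVneq m m'.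
    rewrite /s mE subnn expn0 muln1.
    move: neq; rewrite mE xpair_eqE eqxx/= => ii'.
    by apply/orP; lia.
  have -> : s = (2 * 2 ^ (m' - m).-1)%N.
    by rewrite /s -expnS prednK// subn_gt0 ltn_neqAle mN.
  move: (2 ^ _)%N => r; rewrite mulnCA.
  by apply/orP; lia.
rewrite nodeE /node /=; case/orP: cmp => h; [left|right];
  by rewrite ler_pM2r ?invr_gt0 ?exprn_gt0// ler_pM2l// ler_nat ?addn0.
Qed.

Lemma node_gram_neq m m' i i' : (m, i) != (m', i') -> node_gram m i m' i' = 0.
Proof.
have [mm'|/ltnW mm'] := leqP m m'; first exact: node_gram_level.
by rewrite eq_sym node_gramC; exact: node_gram_level.
Qed.

End haar_line.

(** * Densities perturbed by tensor products of Haar functions *)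

(** Each index [a] stands for a dyadic box of the cube: in direction [j], the
    interval number [pos a j] of level [lev a j]. All boxes have the same volume,
    a fraction [2 ^- k] of the cube. *)
Section haar_family.
Context (R : realType) (d : nat) (M : R) (A : finType).
Variables (lev pos : A -> 'I_d -> nat) (k : nat).
Hypotheses (d0 : (0 < d)%N) (M0 : 0 < M).
Hypothesis pos_lt : forall a j, (pos a j < 2 ^ lev a j)%N.
Hypothesis sum_lev : forall a, (\sum_j lev a j = k)%N.
Hypothesis distinct : forall a b, a != b ->
  exists j, (lev a j, pos a j) != (lev b j, pos b j).
Local Notation corner := {ffun 'I_d -> 'I_3}.
Local Notation mu := (lebesgue R d).
Local Notation E := (euclidean R d).

Definition cube : set E := [set u | forall j, 0 < tnth u j <= M].

Definition vertex a (c : corner) (j : 'I_d) : R := node M (lev a j) (pos a j) (c j).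

(** A product of Haar functions is a signed combination of the [3 ^ d] boxes given by
    the vertices, midpoints included; [sgn_mass c] is the coefficient of the box
    with corner [c]. *)
Definition sgn_mass (c : corner) : R := \prod_j haar_coef R (c j).

Definition haar a (u : E) : R := \sum_c sgn_mass c * box (vertex a c) u.

Definition haar_abs a (u : E) : R := \sum_c `|sgn_mass c| * box (vertex a c) u.

Lemma vertex_ge0 a c j : 0 <= vertex a c j.
Proof. exact: node_ge0. Qed.

Lemma vertex_leM a c j : vertex a c j <= M.
Proof. exact: node_leM. Qed.

Lemma box_cubeC (tau : 'I_d -> R) u : (forall j, tau j <= M) -> ~ cube u ->
  box tau u = 0.
Proof.
move=> tM nu; rewrite boxE; case: forallP => // h; exfalso; apply: nu => j.
by have /andP[-> /le_trans ->] := h j.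
Qed.

Lemma cubeE u : cube u -> box (fun=> M) u = 1.
Proof. by move=> cu; rewrite boxE; case: forallP => // -[] j; exact: cu. Qed.

Lemma cube_orthant : cube `<=` @orthant R d.
Proof. by move=> u cu j; have /andP[] := cu j. Qed.

Lemma measurable_cube : measurable cube.
Proof.
have -> : cube = (box (fun=> M)) @^-1` [set 1].
  apply/seteqP; split => u; first exact: cubeE.
  rewrite /= boxE; case: forallP => [h _ //|_ /eqP].
  by rewrite eq_sym oner_eq0.
rewrite -[X in measurable X]setTI.
by apply: measurable_box => //; exact: measurable_set1.
Qed.

Lemma integral_box_cube (tau : 'I_d -> R) : (forall j, 0 <= tau j <= M) ->
  (\int[mu]_(u in cube) (box tau u)%:E = (\prod_j tau j)%:E)%E.
Proof.
move=> tM; rewrite -integral_box; last by move=> j; have /andP[] := tM j.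
rewrite integral_mkcond; apply: eq_integral => u _; rewrite patchE.
case: ifPn => //; rewrite notin_setE => nu; rewrite box_cubeC// => j.
by have /andP[] := tM j.
Qed.

Lemma cube_lty : (mu cube < +oo)%E.
Proof.
rewrite -[mu cube]mul1e -(@integral_cst _ _ _ mu cube measurable_cube 1).
rewrite (eq_integral (fun u => (box (fun=> M) u)%:E)); last first.
  by move=> u /[!inE] cu; rewrite cubeE.
by rewrite integral_box_cube ?ltry// => j; rewrite ltW//= lexx.
Qed.

Lemma bounded_measurable_box (tau : 'I_d -> R) : bounded_measurable cube (box tau).
Proof.
split; first by apply: measurable_funTS; exact: measurable_box.
by exists 1 => u _; rewrite ger0_norm ?box_ge0// box_le1.
Qed.

Lemma sum_norm_sgn_mass : \sum_c `|sgn_mass c| = 4 ^+ d.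
Proof.
under eq_bigr do rewrite /sgn_mass normr_prod.
rewrite -(bigA_distr_bigA (fun _ c => `|haar_coef R c|)).
by rewrite big_const_ord iter_mulr_1 sum_norm_haar_coef.
Qed.

Lemma sum_sgn_mass_vertex a : \sum_c sgn_mass c * \prod_j vertex a c j = 0.
Proof.
under eq_bigr do rewrite -big_split/=.
rewrite -(bigA_distr_bigA (fun j c => haar_coef R c * node M (lev a j) (pos a j) c)).
by rewrite (bigD1 (Ordinal d0))//= sum_haar_node mul0r.
Qed.

Lemma boxM (s t : 'I_d -> R) u :
  box s u * box t u = box (fun j => Num.min (s j) (t j)) u.
Proof. by rewrite /box -big_split/=; apply: eq_bigr => j _; rewrite indM. Qed.

(** The inner product factors over the directions, and two distinct dyadic boxes
    differ in at least one of them. *)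
Lemma haar_gram a b : Rintegral mu cube (fun u => haar a u * haar b u) =
  (M ^+ d / 2 ^+ k) *+ (a == b).
Proof.
have mc := measurable_cube; have lc := cube_lty.
pose F c c' (u : E) := sgn_mass c * sgn_mass c' *
  box (fun j => Num.min (vertex a c j) (vertex b c' j)) u.
have bF c c' : bounded_measurable cube (F c c').
  apply: bounded_measurableM; first exact: bounded_measurable_cst.
  exact: bounded_measurable_box.
have -> : (fun u => haar a u * haar b u) = (fun u => \sum_c \sum_c' F c c' u).
  apply/funext => u; rewrite /haar mulr_suml; apply: eq_bigr => c _.
  rewrite mulr_sumr; apply: eq_bigr => c' _.
  by rewrite mulrACA boxM.
rewrite (Rintegral_bm_sum mc lc); last first.
  by move=> c; apply: bounded_measurable_sum => c'.
have intF c c' : Rintegral mu cube (F c c') =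
    \prod_j (haar_coef R (c j) * haar_coef R (c' j) *
      Num.min (vertex a c j) (vertex b c' j)).
  rewrite (Rintegral_bmZ mc lc); last exact: bounded_measurable_box.
  rewrite /Rintegral integral_box_cube => [|j].
    by rewrite /sgn_mass -!big_split.
  by rewrite le_min !vertex_ge0 ge_min vertex_leM.
under eq_bigr => c _.
  rewrite (Rintegral_bm_sum mc lc)//.
  under eq_bigr do rewrite intF.
  rewrite -(bigA_distr_bigA (fun j x => haar_coef R (c j) * haar_coef R x *
      Num.min (vertex a c j) (node M (lev b j) (pos b j) x))).
  over.
rewrite -(bigA_distr_bigA (fun j x => \sum_y haar_coef R x * haar_coef R y *
      Num.min (node M (lev a j) (pos a j) x) (node M (lev b j) (pos b j) y))).
rewrite -/(\prod_j node_gram M (lev a j) (pos a j) (lev b j) (pos b j)).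
have [<-|ab] := eqVneq a b.
  under eq_bigr do rewrite node_gram_diag//.
  rewrite big_split/= prodr_const card_ord mulr1n; congr (_ * _).
  by rewrite prodfV prodrXr sum_lev.
have [j hj] := distinct ab.
by rewrite (bigD1 j)//= node_gram_neq// mul0r.
Qed.

Variables (e : R) (s : {ffun A -> bool}).
Hypotheses (e0 : 0 <= e) (esmall : 2 * (e * (#|A|%:R * 4 ^+ d)) * M ^+ d <= 1).

Definition abs_mass : R :=
  \sum_a \sum_c `|sgn_mass c| * \prod_j vertex a c j.

(** The mass left over for the atom at [(M, ..., M)] so that the density integrates
    to [1]. This atom is what keeps the density away from zero on the closed cube. *)
Definition base_weight : R := (1 - e * abs_mass) / M ^+ d.

(** Each signed mass is compensated by its absolute value, so that the weights are
    nonnegative for every choice of the signs [s]. *)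
Definition weight (i : 'I_1 + A * corner) : R :=
  if i is inr x then e * (`|sgn_mass x.2| + (-1) ^+ s x.1 * sgn_mass x.2)
  else base_weight.

Definition corners (i : 'I_1 + A * corner) : 'I_d -> R :=
  if i is inr x then vertex x.1 x.2 else fun=> M.

Let Md0 : 0 < M ^+ d. Proof. exact: exprn_gt0. Qed.

Lemma abs_mass_ge0 : 0 <= abs_mass.
Proof.
apply: sumr_ge0 => a _; apply: sumr_ge0 => c _; rewrite mulr_ge0// prodr_ge0// => j _.
exact: vertex_ge0.
Qed.

Lemma abs_mass_le : abs_mass <= #|A|%:R * 4 ^+ d * M ^+ d.
Proof.
rewrite /abs_mass -mulrA mulr_natl -sumr_const; apply: ler_sum => a _.
rewrite -sum_norm_sgn_mass mulr_suml; apply: ler_sum => c _.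
apply: ler_wpM2l => //.
have -> : M ^+ d = \prod_(j < d) M by rewrite prodr_const card_ord.
by apply: ler_prod => j _; rewrite vertex_ge0 vertex_leM.
Qed.

Lemma base_weight_bounds : (M ^+ d)^-1 / 2 <= base_weight <= (M ^+ d)^-1.
Proof.
have h1 : 2 * (e * abs_mass) <= 1.
  apply: le_trans esmall; rewrite -!mulrA ler_pM2l// ler_wpM2l//.
  by rewrite mulrA abs_mass_le.
have h2 : 0 <= e * abs_mass by rewrite mulr_ge0// abs_mass_ge0.
rewrite /base_weight [_ / M ^+ d]mulrC.
apply/andP; split; first by apply: ler_wpM2l; [rewrite invr_ge0 ltW|lra].
by rewrite -[leRHS]mulr1; apply: ler_wpM2l; [rewrite invr_ge0 ltW|lra].
Qed.

Lemma sum_weight (F : ('I_d -> R) -> R) : \sum_i weight i * F (corners i) =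
  base_weight * F (fun=> M) +
  e * (\sum_a \sum_c `|sgn_mass c| * F (vertex a c)) +
  e * (\sum_a (-1) ^+ s a * \sum_c sgn_mass c * F (vertex a c)).
Proof.
rewrite big_sumType/= big_ord1 -addrA; congr (_ + _).
rewrite -(pair_bigA _ (fun a c => e * (`|sgn_mass c| + (-1) ^+ s a * sgn_mass c) *
   F (vertex a c)))/=.
rewrite !mulr_sumr -big_split; apply: eq_bigr => a _ /=.
rewrite !mulr_sumr -big_split; apply: eq_bigr => c _ /=.
by ring.
Qed.

Lemma weight_ge0 i : 0 <= weight i.
Proof.
case: i => [_|[a c]] /=.
  have /andP[+ _] := base_weight_bounds; apply: le_trans.
  by rewrite divr_ge0// invr_ge0 ltW.
apply: mulr_ge0 => //.
by have := ler_norm (- ((-1) ^+ s a * sgn_mass c)); rewrite normrN normrMsign; lra.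
Qed.

Lemma corners_ge0 i j : 0 <= corners i j.
Proof. by case: i => [_|[a c]] /=; [exact: ltW|exact: vertex_ge0]. Qed.

Lemma sum_weight_prod : \sum_i weight i * \prod_j corners i j = 1.
Proof.
rewrite (sum_weight (fun tau => \prod_j tau j)).
rewrite [X in _ + e * X]big1 => [|a _]; last by rewrite sum_sgn_mass_vertex mulr0.
rewrite mulr0 addr0 prodr_const card_ord /base_weight divfK ?gt_eqF// -/abs_mass.
by rewrite subrK.
Qed.

Definition haar_density : density R d :=
  box_mixture weight_ge0 corners_ge0 sum_weight_prod.

Definition haar_center (u : E) : R :=
  base_weight * box (fun=> M) u + e * \sum_a haar_abs a u.

Lemma haar_densityE u :
  haar_density u = haar_center u + e * \sum_a (-1) ^+ s a * haar a u.
Proof. exact: (sum_weight (fun tau => box tau u)). Qed.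

Lemma haar_density_cubeC u : ~ cube u -> haar_density u = 0.
Proof.
move=> nu; rewrite /= /box_mixture_pdf big1// => i _.
rewrite box_cubeC ?mulr0//; case: i => [_|[a c]] j //=; exact: vertex_leM.
Qed.

Lemma haar_density_bounds u : cube u ->
  (M ^+ d)^-1 / 2 <= haar_density u <= 2 * (M ^+ d)^-1.
Proof.
move=> cu.
have /andP[b1 b2] := base_weight_bounds.
have -> : haar_density u = base_weight +
    \sum_(x : A * corner) weight (inr x) * box (corners (inr x)) u.
  by rewrite /= /box_mixture_pdf big_sumType/= big_ord1 cubeE// mulr1.
have s0 : 0 <= \sum_(x : A * corner) weight (inr x) * box (corners (inr x)) u.
  by apply: sumr_ge0 => x _; rewrite mulr_ge0 ?weight_ge0// box_ge0.
have s1 : \sum_(x : A * corner) weight (inr x) * box (corners (inr x)) u <=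
    2 * (e * (#|A|%:R * 4 ^+ d)).
  apply: (@le_trans _ _ (\sum_(x : A * corner) 2 * e * `|sgn_mass x.2|)).
    apply: ler_sum => -[a c] _; apply: (@le_trans _ _ (weight (inr (a, c)))).
      by rewrite ler_piMr ?weight_ge0// box_le1.
    have -> : 2 * e * `|sgn_mass c| = e * (`|sgn_mass c| + `|sgn_mass c|) by ring.
    by rewrite ler_wpM2l// lerD2l (le_trans (ler_norm _))// normrMsign.
  rewrite -(pair_bigA _ (fun a c => 2 * e * `|sgn_mass c|))/=.
  rewrite sumr_const -mulr_sumr sum_norm_sgn_mass -mulr_natl.
  by rewrite le_eqVlt; apply/orP; left; apply/eqP; ring.
have s2 : 2 * (e * (#|A|%:R * 4 ^+ d)) <= (M ^+ d)^-1.
  by rewrite -[leRHS]mul1r ler_pdivlMr.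
by apply/andP; split; lra.
Qed.

End haar_family.

Section haar_minimax.
Context (R : realType) (d : nat) (M : R) (A : finType).
Variables (lev pos : A -> 'I_d -> nat) (k : nat) (e : R).
Hypotheses (d0 : (0 < d)%N) (M0 : 0 < M).
Hypothesis pos_lt : forall a j, (pos a j < 2 ^ lev a j)%N.
Hypothesis sum_lev : forall a, (\sum_j lev a j = k)%N.
Hypothesis distinct : forall a b, a != b ->
  exists j, (lev a j, pos a j) != (lev b j, pos b j).
Hypotheses (e0 : 0 <= e) (esmall : 2 * (e * (#|A|%:R * 4 ^+ d)) * M ^+ d <= 1).

Let p s := haar_density d0 M0 pos_lt s e0 esmall.

Lemma haar_density_in_class s b B : b <= (M ^+ d)^-1 / 2 ->
  2 * (M ^+ d)^-1 <= B -> @SMU_class R d M b B (p s).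
Proof.
move=> hb hB; split; first exact: box_mixture_SMU.
  move=> u _ [j uj]; apply: haar_density_cubeC => /(_ j) /andP[_].
  by rewrite leNgt uj.
move=> u ou uM.
have cu : cube M u by move=> j; rewrite ou uM.
have /andP[h1 h2] := haar_density_bounds d0 M0 pos_lt s e0 esmall cu.
by rewrite (le_trans hb h1) (le_trans h2 hB).
Qed.

(** For every estimator the average over the hypercube bounds the supremum over the
    class. *)
Lemma haar_minimax n b B : (0 < n)%N ->
  b <= (M ^+ d)^-1 / 2 -> 2 * (M ^+ d)^-1 <= B ->
  n%:R * (e ^+ 2 * (M ^+ d) ^+ 2 / 2 ^+ k) <= 4^-1 ->
  ((#|A|%:R * e ^+ 2 * (M ^+ d) ^+ 2 / (16 * 2 ^+ k))%:E <=
    minimax_risk n (@SMU_class R d M b B))%E.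
Proof.
move=> n0 hb hB hn; apply: le_ereal_inf_tmp => _ [q eq <-].
have Md0 : 0 < M ^+ d by exact: exprn_gt0.
have k0 : 0 < 2 ^+ k :> R by exact: exprn_gt0.
pose v := M ^+ d / 2 ^+ k; pose lo := (M ^+ d)^-1 / 2; pose hi := 2 * (M ^+ d)^-1.
have v0 : 0 < v by exact: divr_gt0.
have lo0 : 0 < lo by rewrite divr_gt0// invr_gt0.
have hi0 : 0 < hi by rewrite mulr_gt0// invr_gt0.
have bbox tau : bounded_measurable (cube M) (box tau).
  exact: bounded_measurable_box.
have bcenter : bounded_measurable (cube M) (haar_center M lev pos e).
  apply: bounded_measurableD; apply: bounded_measurableM => //;
    try exact: bounded_measurable_cst.
  apply: bounded_measurable_sum => a; apply: bounded_measurable_sum => c.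
  by apply: bounded_measurableM => //; exact: bounded_measurable_cst.
have mhaar a : measurable_fun setT (haar M lev pos a).
  apply: measurable_sum => c; apply: measurable_funM => //.
  exact: measurable_box.
have hbnd : exists c : R, forall a u, `|haar M lev pos a u| <= c.
  exists (4 ^+ d) => a u; rewrite -(sum_norm_sgn_mass R d).
  apply: le_trans (ler_norm_sum _ _ _) _; apply: ler_sum => c _.
  by rewrite normrM ler_piMr// ger0_norm ?box_ge0// box_le1.
have hcubeC a u : ~ cube M u -> haar M lev pos a u = 0.
  move=> nu; rewrite /haar big1// => c _; rewrite (box_cubeC (M := M)) ?mulr0// => j.
  exact: vertex_leM.
have hnE : n%:R * (e ^+ 2 * v / (2 * lo)) <= 4^-1.
  apply: le_trans hn; rewrite le_eqVlt; apply/orP; left; apply/eqP.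
  by rewrite /v /lo; field; rewrite !gt_eqF.
have mc : measurable (cube M : set (euclidean R d)) by exact: measurable_cube.
have lc : (lebesgue R d (cube M) < +oo)%E by exact: cube_lty.
have := assouad mc lc (@cube_orthant R d M)
  v0 lo0 hi0 bcenter mhaar hbnd hcubeC
  (fun a b => haar_gram M0 pos_lt sum_lev distinct a b)
  (fun s u _ => haar_densityE d0 M0 pos_lt s e0 esmall u)
  (fun s u => @haar_density_bounds _ _ _ _ _ _ d0 M0 pos_lt _ s e0 esmall u)
  (fun s u => @haar_density_cubeC _ _ _ _ _ _ d0 M0 pos_lt _ s e0 esmall u) n0 hnE eq.
rewrite -/(p _).
have -> : #|A|%:R * e ^+ 2 * v / (8 * hi) =
    #|A|%:R * e ^+ 2 * (M ^+ d) ^+ 2 / (16 * 2 ^+ k).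
  by rewrite /v /hi; field; rewrite !gt_eqF.
move=> low.
set r := ereal_sup _.
have risk_le s : (risk (p s) q <= r)%E.
  by apply: ereal_sup_ubound; exists (p s) => //; exact: haar_density_in_class.
have : (\sum_(s : {ffun A -> bool}) risk (p s) q <= \sum_(s : {ffun A -> bool}) r)%E.
  by apply: lee_sum => s _; exact: risk_le.
move=> /(le_trans low).
have : (0 <= r)%E.
  apply: le_trans (risk_le [ffun=> false]).
  apply: integral_ge0 => x _; apply: integral_ge0 => u _.
  by rewrite lee_fin sqr_ge0.
case: r {risk_le} => [r| |]// _; last by rewrite leey.
rewrite sumEFin sumr_const !lee_fin -[r *+ _]mulr_natl ler_pM2l// ltr0n.
by apply/card_gt0P; exists [ffun=> false].
Qed.

End haar_minimax.

(** * Counting dyadic boxes of a given volume *)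

(** In dimension [d.+1], all directions but the first have a free level in
    [0, r], and the first one completes the sum of the levels to [k]. *)
Section dyadic_index.
Variables (d r : nat).
Let k := (d.+1 * r)%N.
Local Notation levels := {ffun 'I_d -> 'I_r.+1}.
Local Notation positions := {ffun 'I_d.+1 -> 'I_(2 ^ k)}.

Definition level (m : levels) (j : 'I_d.+1) : nat :=
  if unlift ord0 j is Some j' then m j' else (k - \sum_j' m j')%N.

Lemma sum_level m : (\sum_j level m j = k)%N.
Proof.
rewrite big_ord_recl /level unlift_none.
under [X in (_ + X)%N]eq_bigr do rewrite liftK.
rewrite subnK// (@leq_trans (\sum_(j < d) r))//.
  by apply: leq_sum => j _; rewrite -ltnS.
by rewrite sum_nat_const card_ord /k mulSn leq_addl.
Qed.

Lemma level_le m j : (level m j <= k)%N.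
Proof. by rewrite -(sum_level m) (bigD1 j)//= leq_addr. Qed.

Definition dyadic_box (x : levels * positions) : bool :=
  [forall j, x.2 j < 2 ^ level x.1 j]%N.

(** For each of the [r.+1 ^ d] choices of the levels, the dyadic boxes with these
    levels tile the cube. *)
Lemma card_dyadic_box :
  #|{: {x : levels * positions | dyadic_box x}}| = (r.+1 ^ d * 2 ^ k)%N.
Proof.
rewrite card_sig -sum1_card.
rewrite -(pair_big_dep predT (fun m i => dyadic_box (m, i)) (fun _ _ => 1%N))/=.
transitivity (\sum_(m : levels) 2 ^ k)%N; last first.
  by rewrite sum_nat_const card_ffun !card_ord.
apply: eq_bigr => m _.
transitivity (\prod_j \sum_(i < 2 ^ k | i < 2 ^ level m j) 1)%N.
  rewrite bigA_distr_big_dep; apply: eq_big => [i|i _]; last by rewrite big1.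
  exact/forallP/familyP.
rewrite -[in RHS](sum_level m) expn_sum; apply: eq_bigr => j _.
have lek : (2 ^ level m j <= 2 ^ k)%N by rewrite leq_pexp2l ?level_le.
by rewrite (big_ord_narrow lek) sum1_card card_ord.
Qed.

Lemma dyadic_box_distinct (x y : {x : levels * positions | dyadic_box x}) :
  x != y -> exists j, (level (val x).1 j, (val x).2 j : nat) !=
                      (level (val y).1 j, (val y).2 j : nat).
Proof.
move=> xy; apply/existsP; apply: contraR xy.
rewrite negb_exists => /forallP h; apply/eqP/val_inj.
have {}h j : (level (val x).1 j, (val x).2 j : nat) =
    (level (val y).1 j, (val y).2 j : nat).
  by apply/eqP; rewrite -[_ == _]negbK.
case: (val x) (val y) h => [m i] [m' i'] /= h; congr pair.
  apply/ffunP => j; apply: val_inj.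
  by have [] := h (lift ord0 j); rewrite /level liftK.
by apply/ffunP => j; apply: val_inj; have [] := h j.
Qed.

End dyadic_index.

(** * The choice of the resolution and the minimax bound *)

Section rates.
Variable R : realType.

(** With [N] dyadic boxes of relative volume [2 ^- k], the sample size at which the
    signs are about to become detectable is [N ^ 2 * 2 ^ k] up to a constant; this
    is its value for [N = r.+1 ^ d.-1 * 2 ^ k] and [k = d * r]. *)
Definition cells (d r : nat) : nat := (r.+1 ^ (2 * d.-1) * 2 ^ (3 * (d * r)))%N.

Lemma cells_scale d n : (0 < d)%N -> (2 <= n)%N ->
  exists r, (cells d r <= n < cells d r.+1)%N.
Proof.
move=> d0 n2.
have ex : exists r, (cells d r <= n)%N.
  by exists 0%N; rewrite /cells exp1n muln0; lia.
have bound r : (cells d r <= n)%N -> (r <= n)%N.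
  move=> h; apply: leq_trans h; apply: leq_trans (ltnW (ltn_expl r (ltnSn 1))) _.
  rewrite /cells -[leqLHS]mul1n leq_mul ?expn_gt0// leq_pexp2l//; nia.
case: (ex_maxnP ex bound) => r hr rmax; exists r; rewrite hr/= ltnNge.
by apply/negP => /rmax; rewrite ltnn.
Qed.

(** One step of [r] changes the critical sample size by a bounded factor, so a grid
    of resolutions is enough to reach every [n]. *)
Lemma cells_doubling d r : (0 < d)%N ->
  (4 * cells d r.+1 <= 2 ^ (6 * d) * cells d r)%N.
Proof.
case: d => // d _; rewrite /cells /=.
have h : (r.+2 ^ (2 * d) <= 2 ^ (2 * d) * r.+1 ^ (2 * d))%N.
  by case: d => [//|e]; rewrite -expnMn leq_exp2r//; lia.
have -> : (3 * (d.+1 * r.+1) = 3 * (d.+1 * r) + 3 * d.+1)%N by lia.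
rewrite expnD.
have -> : (4 * (r.+2 ^ (2 * d) * (2 ^ (3 * (d.+1 * r)) * 2 ^ (3 * d.+1))) =
  r.+2 ^ (2 * d) * (4 * 2 ^ (3 * d.+1)) * 2 ^ (3 * (d.+1 * r)))%N by lia.
rewrite [leqRHS]mulnA leq_mul2r; apply/orP; right.
apply: leq_trans (leq_mul h (leqnn _)) _.
rewrite mulnAC leq_mul2r; apply/orP; right.
rewrite -[4%N]/(2 ^ 2)%N -!expnD leq_pexp2l//; lia.
Qed.

Lemma ln_cells_le d n r : (0 < d)%N -> (2 <= n)%N -> (n < cells d r.+1)%N ->
  ln n%:R <= (5 * d * r.+1)%:R :> R.
Proof.
move=> d0 n2 hn.
have n_le : (n <= 2 ^ (5 * d * r.+1))%N.
  apply: leq_trans (ltnW hn) _; rewrite /cells.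
  apply: (@leq_trans (2 ^ (r.+1 * (2 * d.-1)) * 2 ^ (3 * (d * r.+1)))%N).
    rewrite leq_mul2r (expnM 2 r.+1); apply/orP; right.
    case: d.-1 => [//|e]; rewrite leq_exp2r//.
    exact: ltn_expl.
  by rewrite -expnD leq_pexp2l//; nia.
have n0 : (0 : R) < n%:R by rewrite ltr0n; lia.
apply: (@le_trans _ _ (ln (2 ^+ (5 * d * r.+1)))).
  rewrite ler_ln ?posrE ?exprn_gt0//.
  by rewrite -natrX ler_nat.
rewrite lnXn//.
have ln2 : ln 2 <= 1 :> R.
  have := @le_ln1Dx R 1; rewrite (_ : 1 + 1 = 2)//; apply.
  by lra.
by rewrite -[leLHS]mulr_natr ler_piMl.
Qed.

(** After taking cubes the exponents are integers. The lower bound on [n] controls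
    [n ^- 2]; the upper bound gives [ln n <= 5 * d * r.+1], which turns the power of
    the logarithm into one more factor [r.+1 ^ d.-1]. *)
Lemma rate_le d n r : (0 < d)%N -> (2 <= n)%N ->
  (cells d r <= n < cells d r.+1)%N ->
  n%:R `^ (- (2 / 3)) * ln n%:R `^ ((d%:R - 1) / 3) <=
  (5 * d)%:R ^+ d.-1 / (r.+1%:R ^+ d.-1 * 2 ^+ (2 * (d * r))) :> R.
Proof.
move=> d0 n2 /andP[lo hi].
have n0 : (0 : R) < n%:R by rewrite ltr0n; lia.
have lnn := ln_cells_le d0 n2 hi.
have ln0 : 0 <= ln n%:R :> R by apply: ln_ge0; rewrite ler1n; lia.
set Y := leRHS.
have Y0 : 0 <= Y by rewrite divr_ge0 ?mulr_ge0 ?exprn_ge0.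
rewrite -(@ler_pXn2r _ 3)// ?nnegrE ?mulr_ge0 ?powR_ge0// exprMn.
have -> : (n%:R `^ (- (2 / 3))) ^+ 3 = n%:R ^- 2 :> R.
  rewrite -powR_mulrn ?powR_ge0// -powRrM mulNr divfK//.
  by rewrite powR_invn// ltW.
have -> : (ln n%:R `^ ((d%:R - 1) / 3)) ^+ 3 = ln n%:R ^+ d.-1 :> R.
  rewrite -powR_mulrn ?powR_ge0// -powRrM divfK// -powR_mulrn//.
  by congr (_ `^ _); case: d d0 {lo hi lnn Y Y0} => // d _; rewrite -natr1 addrK.
have cells0 : (0 : R) < (cells d r)%:R by rewrite ltr0n muln_gt0 !expn_gt0.
apply: (@le_trans _ _ ((cells d r)%:R ^- 2 * (5 * d * r.+1)%:R ^+ d.-1)).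
  apply: ler_pM => //; rewrite ?invr_ge0 ?exprn_ge0//.
    rewrite lef_pV2 ?posrE ?exprn_gt0//.
    by apply: lerXn2r; rewrite ?nnegrE ?ler0n ?ler_nat.
  by apply: lerXn2r; rewrite ?nnegrE.
rewrite /Y /cells natrM exprMn natrM !natrX -!exprM expr_div_n exprMn -!exprM.
have -> : (2 * d.-1 * 2 = d.-1 * 4)%N by lia.
have -> : (3 * (d * r) * 2 = 2 * (d * r) * 3)%N by lia.
rewrite (exprM _ d.-1 4) (exprM _ (2 * (d * r))%N 3) (exprM _ d.-1 3).
have D1 : 1 <= (5 * d)%:R ^+ d.-1 :> R by rewrite exprn_ege1// ler1n; lia.
have L0 : 0 < r.+1%:R ^+ d.-1 :> R by rewrite exprn_gt0.
have P0 : 0 < 2 ^+ (2 * (d * r)) :> R by rewrite !exprn_gt0.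
move: D1 L0 P0.
move: (_ ^+ d.-1) (r.+1%:R ^+ d.-1) (2 ^+ (2 * (d * r))) => D L P D1 L0 P0.
have -> : (L ^+ 4 * P ^+ 3)^-1 * (D * L) = D / (L * P) ^+ 3.
  by field; rewrite !gt_eqF.
rewrite ler_pM2r ?invr_gt0 ?exprn_gt0 ?mulr_gt0//.
by rewrite -[leLHS]expr1 ler_weXn2l.
Qed.

End rates.

Theorem theorem4p6 (R : realType) (d : nat) (hd : (0 < d)%N) :
  exists c C : R, [/\ 0 < c, 0 < C &
    forall (n : nat) (M b B : R), (2 <= n)%N ->
      C < B -> C < b^-1 -> C < M ->
      b * M ^+ d <= 2^-1 ->
      ((c * n%:R `^ (- (2 / 3)) * ln n%:R `^ ((d%:R - 1) / 3))%:E
         <= minimax_risk n (@SMU_class R d M b B))%E ].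
Proof.
case: d hd => // d hd.
have exponents : ((2 * d.+1).+1 <= 3 * d.+1)%N by lia.
pose F : R := 2 ^+ (3 * d.+1); pose D : R := (5 * d.+1)%:R ^+ d.
have F0 : 0 < F by exact: exprn_gt0.
have D0 : 0 < D by rewrite exprn_gt0// ltr0n.
exists (16 * F ^+ 2 * D)^-1, 2; split=> //.
  by rewrite invr_gt0 !mulr_gt0// exprn_gt0.
move=> n M b B n2 hB _ hM hbM.
have M0 : 0 < M by lra.
set V := M ^+ d.+1 in hbM.
have V0 : 0 < V by exact: exprn_gt0.
have V1 : 1 <= V by rewrite exprn_ege1//; lra.
have [r hr] := cells_scale hd n2.
have rate := rate_le R hd n2 hr; rewrite /= in rate.
have n4 : (4 * n <= 2 ^ (6 * d.+1) * cells d.+1 r)%N.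
  apply: leq_trans (cells_doubling r hd); rewrite leq_mul2l/= ltnW//.
  by have /andP[] := hr.
pose k := (d.+1 * r)%N.
pose A : finType :=
  {x : {ffun 'I_d -> 'I_r.+1} * {ffun 'I_d.+1 -> 'I_(2 ^ k)} | dyadic_box x}.
pose lev (a : A) j := level (val a).1 j.
pose pos (a : A) j : nat := (val a).2 j.
have pos_lt a j : (pos a j < 2 ^ lev a j)%N by have /forallP := valP a; apply.
have sum_lev a : (\sum_j lev a j = k)%N by exact: sum_level.
have cardA : #|A| = (r.+1 ^ d * 2 ^ k)%N by exact: card_dyadic_box.
pose L : R := r.+1%:R ^+ d; pose K : R := 2 ^+ k.
have NE : #|A|%:R = L * K :> R by rewrite cardA natrM !natrX.
have L0 : 0 < L by exact: exprn_gt0.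
have K0 : 0 < K by exact: exprn_gt0.
have {}n4 : 4 * n%:R <= F ^+ 2 * (L ^+ 2 * K ^+ 3) :> R.
  rewrite -natrM; apply: le_trans (_ : _ <= (2 ^ (6 * d.+1) * cells d.+1 r)%:R) _.
    by rewrite ler_nat.
  rewrite /cells /= !natrM !natrX /F /L /K -!exprM.
  have -> : (3 * d.+1 * 2 = 6 * d.+1)%N by rewrite mulnAC.
  by rewrite (mulnC d 2) (mulnC k 3).
have {}rate : n%:R `^ (- (2 / 3)) * ln n%:R `^ ((d.+1%:R - 1) / 3) <=
    D / (L * K ^+ 2).
  have -> : K ^+ 2 = 2 ^+ (2 * (d.+1 * r)) by rewrite /K -exprM mulnC.
  exact: rate.
(* The amplitude is as large as nonnegativity of the base weight permits, up to
   the factor [F]. *)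
pose e : R := (F * (L * K) * V)^-1.
have e0 : 0 <= e by rewrite invr_ge0 !mulr_ge0// ltW.
have esmall : 2 * (e * (#|A|%:R * 4 ^+ d.+1)) * V <= 1.
  have -> : 2 * (e * (#|A|%:R * 4 ^+ d.+1)) * V = 2 * 4 ^+ d.+1 / F.
    by rewrite NE /e; field; rewrite !gt_eqF.
  have -> : 2 * 4 ^+ d.+1 = 2 ^+ (2 * d.+1).+1 :> R.
    by rewrite [RHS]exprS exprM -(natrX _ 2 2).
  by rewrite ler_pdivrMr// mul1r ler_weXn2l ?ler1n.
have := @haar_minimax R d.+1 M A lev pos k e isT M0 pos_lt sum_lev
  (@dyadic_box_distinct d r) e0 esmall n b B (ltnW n2).
rewrite -/V -/K NE.
have -> : L * K * e ^+ 2 * V ^+ 2 / (16 * K) = (16 * F ^+ 2 * (L * K ^+ 2))^-1.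
  by rewrite /e; field; rewrite !gt_eqF.
move=> lower; apply: le_trans (lower _ _ _).
- rewrite lee_fin -mulrA.
  apply: (@le_trans _ _ ((16 * F ^+ 2 * D)^-1 * (D / (L * K ^+ 2)))).
    by apply: ler_wpM2l rate; rewrite invr_ge0 !mulr_ge0// ?sqr_ge0// ltW.
  by rewrite le_eqVlt; apply/orP; left; apply/eqP; field; rewrite !gt_eqF.
- by rewrite [leRHS]mulrC ler_pdivlMr.
- by rewrite ler_pdivrMr//; nra.
- have -> : e ^+ 2 * V ^+ 2 / K = (F ^+ 2 * (L ^+ 2 * K ^+ 3))^-1.
    by rewrite /e; field; rewrite !gt_eqF.
  rewrite ler_pdivrMr ?mulr_gt0 ?exprn_gt0//; lra.
Qed.
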